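(* Let $\mathcal C$ be any class of graphs of bounded twin-width. All-Pairs Shortest Path on $n$-vertex graphs of $\mathcal C$ can be solved in time $O(n^2\log^2 n)$ with high probability, i.e., with probability at least $1-n^{-c}$ for any fixed but arbitrarily large constant $c>0$.
   Context: Twin-width: a trigraph is a graph whose edges are colored black or red. Contracting two vertices $u,v$ of a trigraph replaces them by a new vertex $w$ such that for every other vertex $x$: $wx$ is black if $ux,vx$ are both black edges, $wx$ is absent if neither $ux$ nor $vx$ is an edge, and $wx$ is red otherwise. A graph $G$ (all edges black) has twin-width at most $d$ if there is a sequence of contractions reducing it to a single vertex in which every intermediate trigraph has maximum red degree at most $d$. A class has bounded twin-width if some $d$ bounds the twin-width of all its members. All-Pairs Shortest Path asks for the distances between all pairs of vertices of an unweighted graph; no contraction sequence is given as input. *)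

(* Defs.v *)
From mathcomp Require Import all_boot all_order all_algebra.
From mathcomp Require Import boolp reals exp.

Set Implicit Arguments.
Unset Strict Implicit.
Unset Printing Implicit Defensive.

Import Order.TTheory GRing.Theory Num.Theory.

Record sgraph (n : nat) := SGraph {
  adj :> rel 'I_n;
  adj_sym : symmetric adj;
  adj_irr : irreflexive adj
}.

Definition graph_class := forall n : nat, sgraph n -> Prop.

Inductive ecolor := NoEdge | Black | Red.

Definition is_red (c : ecolor) : bool := if c is Red then true else false.

(* The vertex set is a subset of a fixed ambient type, so that a contraction
   does not change the type. *)
Record trigraph (V : finType) := Trigraph {
  tverts : {set V};
  tedge : V -> V -> ecolor
}.

Definition trigraph_of n (G : sgraph n) : trigraph 'I_n :=
  Trigraph [set: 'I_n] (fun x y => if G x y then Black else NoEdge).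

Definition merge_color (c1 c2 : ecolor) : ecolor :=
  match c1, c2 with
  | Black, Black => Black
  | NoEdge, NoEdge => NoEdge
  | _, _ => Red
  end.

(* The new vertex w of the contraction of u and v takes over the name u. *)
Definition contract (V : finType) (H : trigraph V) (u v : V) : trigraph V :=
  Trigraph (tverts H :\ v)
    (fun x y =>
       if x == u then
         if y == u then NoEdge
         else merge_color (tedge H u y) (tedge H v y)
       else if y == u then merge_color (tedge H x u) (tedge H x v)
       else tedge H x y).

Definition red_degree (V : finType) (H : trigraph V) (x : V) : nat :=
  #|[set y in tverts H | is_red (tedge H x y)]|.

Definition max_red_degree (V : finType) (H : trigraph V) : nat :=
  \max_(x in tverts H) red_degree H x.

(* In [contractible_done], [<= 1] instead of [= 1] only matters for the graph
   without vertices. *)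
Inductive contractible (V : finType) (d : nat) : trigraph V -> Prop :=
| contractible_done H :
    max_red_degree H <= d -> #|tverts H| <= 1 -> contractible d H
| contractible_step H u v :
    max_red_degree H <= d ->
    u \in tverts H -> v \in tverts H -> u != v ->
    contractible d (contract H u v) -> contractible d H.

Definition twin_width_le n (G : sgraph n) (d : nat) : Prop :=
  contractible d (trigraph_of G).

Definition bounded_twin_width (C : graph_class) : Prop :=
  exists d, forall n (G : sgraph n), C n G -> twin_width_le G d.

Definition is_dist n (G : sgraph n) (u v : 'I_n) (k : nat) : Prop :=
  (exists p, [/\ path G u p, last u p = v & size p = k]) /\
  (forall p, path G u p -> last u p = v -> k <= size p).

(* Randomized word RAM. Programs are structured, which costs only a constant
   factor compared with jumps. Every operator, memory access, test and
   command takes one unit of time. *)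

Inductive binop :=
  | OAdd | OSub | OMul | ODiv | OMod | OEq | OLt | OAnd | OOr | OXor | OShl | OShr.

Inductive expr :=
| Cst of nat
| Reg of nat
| Fetch of expr
| Bin of binop & expr & expr.

Inductive cmd :=
| Skip
| Assign of nat & expr
| Store of expr & expr
| Rand of nat
| Seq of cmd & cmd
| If of expr & cmd & cmd
| While of expr & cmd.

(* [tape] is the stream of random words not yet consumed. *)
Record state := State {
  regs : nat -> nat;
  memory : nat -> nat;
  tape : nat -> nat
}.

Definition upd (f : nat -> nat) (a x : nat) : nat -> nat :=
  fun b => if b == a then x else f b.

(* [OSub] is truncated at 0; division and remainder by 0 follow [divn] and
   [modn]. *)
Definition eval_binop (o : binop) (a b : nat) : nat :=
  match o with
  | OAdd => a + b
  | OSub => a - b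
  | OMul => a * b
  | ODiv => a %/ b
  | OMod => a %% b
  | OEq => a == b
  | OLt => a < b
  | OAnd => Nat.land a b
  | OOr => Nat.lor a b
  | OXor => Nat.lxor a b
  | OShl => a * 2 ^ b
  | OShr => a %/ 2 ^ b
  end.

(* [w] is the word length: values are reduced modulo [2 ^ w]. *)
Fixpoint eval (w : nat) (s : state) (e : expr) : nat :=
  match e with
  | Cst a => a %% 2 ^ w
  | Reg r => regs s r
  | Fetch e1 => memory s (eval w s e1)
  | Bin o e1 e2 => eval_binop o (eval w s e1) (eval w s e2) %% 2 ^ w
  end.

Fixpoint ecost (e : expr) : nat :=
  match e with
  | Cst _ | Reg _ => 1
  | Fetch e1 => (ecost e1).+1
  | Bin _ e1 e2 => (ecost e1 + ecost e2).+1
  end.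

(* [exec w c s t s']: started in [s], the program [c] halts in [s'] after
   exactly [t] time units. *)
Inductive exec (w : nat) : cmd -> state -> nat -> state -> Prop :=
| exec_skip s : exec w Skip s 1 s
| exec_assign s r e :
    exec w (Assign r e) s (ecost e).+1
      (State (upd (regs s) r (eval w s e)) (memory s) (tape s))
| exec_store s e1 e2 :
    exec w (Store e1 e2) s (ecost e1 + ecost e2).+1
      (State (regs s) (upd (memory s) (eval w s e1) (eval w s e2)) (tape s))
| exec_rand s r :
    exec w (Rand r) s 1
      (State (upd (regs s) r (tape s 0)) (memory s) (fun i => tape s i.+1))
| exec_seq s s1 s2 c1 c2 t1 t2 :
    exec w c1 s t1 s1 -> exec w c2 s1 t2 s2 ->
    exec w (Seq c1 c2) s (t1 + t2).+1 s2
| exec_if s s1 e c1 c2 t :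
    exec w (if eval w s e != 0 then c1 else c2) s t s1 ->
    exec w (If e c1 c2) s (ecost e + t).+1 s1
| exec_while_stop s e c :
    eval w s e = 0 -> exec w (While e c) s (ecost e).+1 s
| exec_while_loop s s1 s2 e c t1 t2 :
    eval w s e <> 0 -> exec w c s t1 s1 -> exec w (While e c) s1 t2 s2 ->
    exec w (While e c) s (ecost e + t1 + t2).+1 s2.

(* Register 0 holds n, cell [u * n + v] holds the (u, v) entry of the
   adjacency matrix, everything else is 0. *)
Definition input_mem n (G : sgraph n) (a : nat) : nat :=
  [exists u : 'I_n, exists v : 'I_n, (a == u * n + v) && G u v].

Definition init_state n (G : sgraph n) (tp : nat -> nat) : state :=
  State (upd (fun _ => 0) 0 n) (input_mem G) tp.

(* The answer for (u, v) is read in cell [n * n + (u * n + v)]; since finite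
   distances are smaller than n, the value n stands for infinity. *)
Definition apsp_output n (G : sgraph n) (m : nat -> nat) : Prop :=
  forall u v : 'I_n,
    if connect G u v then is_dist G u v (m (n * n + (u * n + v)))
    else m (n * n + (u * n + v)) = n.

Definition solves_apsp_within (w T : nat) (prog : cmd) n (G : sgraph n)
    (tp : nat -> nat) : Prop :=
  exists t s, [/\ t <= T, exec w prog (init_state G tp) t s
                & apsp_output G (memory s)].

(* A run of at most T steps reads at most T random words, so a finite tape
   with T independent uniform words suffices. *)
Definition tape_of (w T : nat) (o : {ffun 'I_T -> 'I_(2 ^ w)}) (i : nat) : nat :=
  if insub i is Some j then val (o j) else 0.

Definition apsp_success_prob (R : realType) (w T : nat) (prog : cmd)
    n (G : sgraph n) : R :=
  (#|[set o : {ffun 'I_T -> 'I_(2 ^ w)} |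
        `[< solves_apsp_within w T prog G (tape_of o) >]]|%:R
   / #|{ffun 'I_T -> 'I_(2 ^ w)}|%:R)%R.

(* k times the number of binary digits of n. *)
Definition word_length (k n : nat) : nat := k * (trunc_log 2 n).+1.

(* Main.v *)
Require Import Defs.
From mathcomp Require Import all_boot all_order all_algebra.
From mathcomp Require Import boolp reals sequences exp.
From mathcomp Require Import zify ring lra.

(** Draw [N = a n log n] random columns of the adjacency matrix and sort its rows
    lexicographically by these columns, with one stable partition per column.
    Bounded twin-width enters only through linear neighbourhood complexity: the
    rows have [O(l)] distinct restrictions to any [l] columns, so at most [O(l)]
    consecutive rows of the sorted matrix differ in the [l] most significant
    columns. With high probability two rows at Hamming distance [D] are already
    separated by the [N / D] most significant columns. Summing over dyadic values
    of [D], the distances of consecutive rows add up to [O(n log^2 n)], and by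
    symmetry this bounds the total number of runs of equal entries in all rows of
    the matrix whose columns have been reordered in the same way.

    A breadth-first search can then explore the neighbours of a vertex run by run:
    the unvisited vertices of a run are enumerated by a union-find structure on
    intervals which relabels the smaller block, so that finds take constant time
    and all unions together take [O(n log n)]. Each of the [n] searches takes
    [O(n log^2 n)]. *)

Set Implicit Arguments.
Unset Strict Implicit.
Unset Printing Implicit Defensive.

Import Order.TTheory GRing.Theory Num.Theory.

(** * Linear neighbourhood complexity *)

(** No contraction sequence is available and none is computed: twin-width occurs only in the
    analysis, through [card_traces_le]. Its proof follows the unknown sequence until two elements
    [x], [x'] of the column set [S] fall into one part; few traces separate them, so deleting [x']
    from [S] loses only a constant number of traces. One sort serves all scales at once, because
    ordering by all [N] columns also orders by the last [l] of them, for each [l]. A random word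
    hits a column separating two rows at distance [D] with probability at least D/(2n), so a window
    of N/D columns misses with probability at most n^{-(c+2)}, and a union bound over n^2 pairs
    leaves n^{-c}. One logarithm of the run count comes from [N], the other from the number of
    dyadic scales. The searches are correct for every vertex order; the random columns influence
    only the running time. *)

Definition trace n (G : sgraph n) (S : {set 'I_n}) (v : 'I_n) : {set 'I_n} :=
  [set y in S | G v y].

Definition traces n (G : sgraph n) (S : {set 'I_n}) : {set {set 'I_n}} :=
  [set trace G S v | v in 'I_n].

(** Invariant carried along a contraction sequence, where [rep a] stands for the part containing
    [a]: black and absent edges mean homogeneous pairs of parts, while red promises nothing. *)
Definition quotient_trigraph n (G : sgraph n) (H : trigraph 'I_n)
    (rep : 'I_n -> 'I_n) : Prop :=
  (forall a, rep a \in tverts H) /\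
  (forall a b, rep a != rep b ->
     match tedge H (rep a) (rep b) with
     | Black => G a b | NoEdge => ~~ G a b | Red => true end).

Lemma contractible_red_degree (V : finType) d (H : trigraph V) x :
  contractible d H -> x \in tverts H -> red_degree H x <= d.
Proof.
move=> cH xH; have le_max : red_degree H x <= max_red_degree H.
  exact: (@leq_bigmax_cond _ (fun x => x \in tverts H) (red_degree H)).
by apply: leq_trans le_max _; case: cH.
Qed.

(** [merge_color] yields a colour other than red only when both old pairs carry that colour, so
    homogeneity survives the merge. *)
Lemma quotient_contract n (G : sgraph n) H rep u v :
  u \in tverts H -> u != v -> quotient_trigraph G H rep ->
  quotient_trigraph G (contract H u v) (fun a => if rep a == v then u else rep a).
Proof.
move=> uH uv [repH hom]; split=> [a|a b] /=.
  have [_|av] := boolP (rep a == v); first by rewrite !inE uv uH.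
  by rewrite !inE av repH.
have homE a' b' x y : rep a' = x -> rep b' = y -> x != y ->
    match tedge H x y with
    | Black => G a' b' | NoEdge => ~~ G a' b' | Red => true end.
  by move=> <- <-; apply: hom.
have vu : v != u by rewrite eq_sym.
have [av|av] := boolP (rep a == v); have [bv|bv] := boolP (rep b == v).
- by rewrite eqxx.
- move=> ub; have bu : (rep b == u) = false by rewrite eq_sym; apply: negbTE.
  rewrite eqxx bu.
  have := @homE a b v (rep b) (eqP av) erefl; rewrite eq_sym bv => /(_ isT).
  by case: (tedge H u _); case: (tedge H v _).
- move=> au; rewrite (negPf au) eqxx.
  have := @homE a b (rep a) v erefl (eqP bv) av.
  by case: (tedge H _ u); case: (tedge H _ v).
move=> ab; have [au|au] := boolP (rep a == u).
  have bu : (rep b == u) = false by rewrite -(eqP au) eq_sym; apply: negbTE.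
  rewrite bu; have := @homE a b u (rep b) (eqP au) erefl.
  rewrite eq_sym bu => /(_ isT).
  by case: (tedge H u _); case: (tedge H v _).
have [bu|bu] := boolP (rep b == u); last exact: homE.
have := @homE a b (rep a) u erefl (eqP bu) au.
by case: (tedge H _ u); case: (tedge H _ v).
Qed.

Lemma leq_card_bigcup (I T : finType) (P : {set I}) (F : I -> {set T}) :
  #|\bigcup_(i in P) F i| <= \sum_(i in P) #|F i|.
Proof.
elim/big_rec2: _ => [|i k A _ IH]; first by rewrite cards0.
apply: leq_trans (leq_card_setU _ _).1 _; exact: leq_add.
Qed.

(** A vertex of part [p] sees each [y] outside [Y] as prescribed by the black or absent edge from
    [p] to the part of [y], so its trace is determined on [Y]. The at most d + 1 parts of [N]
    contain one element of [S] each, apart from the exceptional [x], whence d + 2. *)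
Lemma card_traces_of_part n (G : sgraph n) H rep d S (p x : 'I_n) :
  quotient_trigraph G H rep -> red_degree H p <= d ->
  {in S :\ x &, injective rep} ->
  #|[set trace G S v | v in [set v | rep v == p]]| <= 2 ^ d.+2.
Proof.
move=> [repH hom] dp injS.
set N := p |: [set y in tverts H | is_red (tedge H p y)].
set Y := [set y in S | rep y \in N].
have cardN : #|N| <= d.+1.
  rewrite cardsU1; case: (p \notin _) => //=; rewrite ?add1n ?ltnS //.
  exact: leq_trans dp _.
have cardY : #|Y| <= d.+2.
  have YD : #|Y :\ x| <= d.+1.
    rewrite -(card_in_imset (f := rep)); last first.
      move=> a b; rewrite !inE => /and3P[ax aS _] /and3P[bx bS _].
      by apply: injS; rewrite !inE ?ax ?bx.
    apply: leq_trans cardN; apply: subset_leq_card; apply/subsetP => z.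
    by move=> /imsetP[y]; rewrite !inE => /and3P[_ _ yN] ->.
  rewrite (cardsD1 x) -[d.+2]add1n; apply: leq_add => //.
  exact: leq_b1.
set F := [set trace G S v | v in _].
have injF : {in F &, injective (fun T => T :&: Y)}.
  move=> _ _ /imsetP[v] + -> /imsetP[v'] + -> /setP eqY.
  rewrite !inE => /eqP vp /eqP v'p; apply/setP => y.
  have [yY|yY] := boolP (y \in Y); first by have := eqY y; rewrite !in_setI yY !andbT.
  move: yY; rewrite !inE; case: (y \in S) => //=.
  rewrite negb_or => /andP[yp]; rewrite repH /= => nred.
  have := hom v y; have := hom v' y; rewrite vp v'p eq_sym yp => /(_ isT) + /(_ isT).
  by move: nred; case: (tedge _ _ _) => // _; do 2![move/negPf->|move->].
rewrite -(card_in_imset injF) (leq_trans (n := #|powerset Y|)) //.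
  apply: subset_leq_card; apply/subsetP => _ /imsetP[T _ ->].
  by rewrite powersetE subsetIr.
by rewrite card_powerset leq_exp2l.
Qed.

(* Stop at the first contraction that puts two elements of [S] in one part:
   every vertex separating them lies in one of at most [d + 1] parts, and each
   part sees all but [d + 2] elements of [S] homogeneously. *)
Lemma exists_close_pair n (G : sgraph n) d H rep (S : {set 'I_n}) :
  contractible d H -> quotient_trigraph G H rep ->
  {in S &, injective rep} -> 1 < #|S| ->
  exists x x', [/\ x \in S, x' \in S, x != x' &
    #|[set trace G S v | v in [set v | G v x != G v x']]| <= d.+1 * 2 ^ d.+2].
Proof.
move=> cH; elim: cH rep => {H} [H _ H1|H u v _ uH vH uv cH IH] rep qH injS S1.
  have : #|rep @: S| <= #|tverts H|.
    apply: subset_leq_card; apply/subsetP => _ /imsetP[y _ ->].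
    by case: qH => ->.
  by rewrite card_in_imset // => /leq_ltn_trans /(_ (leq_ltn_trans H1 S1)); rewrite ltnn.
have := quotient_contract uH uv qH; set H' := contract H u v.
set rep' := fun a => _ => qH'.
have [/injectiveP|] := boolP (injectiveb (fun y : {y | y \in S} => rep' (val y))).
  move=> inj'; apply: IH qH' _ S1 => a b aS bS /= e.
  by have [] := inj' (exist _ a aS) (exist _ b bS) e.
case/injectivePn => -[x xS] [[x' x'S] /= xx' e].
have {}xx' : x != x' by [].
exists x, x'; split=> //.
(* [x] and [x'] coincide under [rep'] but not under [rep], so one of them lay in part [v] and the
   other in part [u]. *)
have x_u : rep' x = u.
  move: e; rewrite /rep'; case: (eqVneq (rep x) v) => // xv.
  case: (eqVneq (rep x') v) => // x'v /(injS _ _ xS x'S) exx.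
  by rewrite exx eqxx in xx'.
have x'_u : rep' x' = u by rewrite -e.
(* This is the first collision, and no third element of [S] can be in the merged part: dropping [x']
   restores injectivity. *)
have injS' : {in S :\ x' &, injective rep'}.
  have rep'E a : a \in S :\ x' -> a != x -> rep' a = rep a /\ rep a != u.
    rewrite !inE => /andP[ax' aS] ax.
    have av : rep a != v.
      apply: contraTneq (isT) => av; move: x_u x'_u; rewrite /rep'.
      case: (eqVneq (rep x) v) => [xv|_ xu].
        by move/eqP: ax; case; apply: injS; rewrite // av.
      case: (eqVneq (rep x') v) => [x'v|_ x'u].
        by move/eqP: ax'; case; apply: injS; rewrite // av.
      by move/eqP: xx'; case; apply: injS; rewrite // xu.
    split; first by rewrite /rep' (negPf av).
    apply: contraTneq (isT) => au; move: x_u x'_u; rewrite /rep'.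
    case: (eqVneq (rep x) v) => [xv|_ xu]; last first.
      by move/eqP: ax; case; apply: injS; rewrite // au.
    case: (eqVneq (rep x') v) => [x'v|_ _ x'u]; last first.
      by move/eqP: ax'; case; apply: injS; rewrite // au.
    by move/eqP: xx'; case; apply: injS; rewrite // xv.
  move=> a b aS bS eab; apply/eqP.
  have [ax|ax] := eqVneq a x; have [bx|bx] := eqVneq b x; rewrite ?ax ?bx //.
  - by have [e1 e2] := rep'E b bS bx; move: eab; rewrite ax x_u e1 => /eqP; rewrite eq_sym (negPf e2).
  - by have [e1 e2] := rep'E a aS ax; move: eab; rewrite bx x_u e1 => /eqP; rewrite (negPf e2).
  have [ea _] := rep'E a aS ax; have [eb _] := rep'E b bS bx.
  rewrite ea eb in eab; apply/eqP; apply: injS => //.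
    by move: aS; rewrite !inE => /andP[].
  by move: bS; rewrite !inE => /andP[].
set P := u |: [set y in tverts H' | is_red (tedge H' u y)].
have uH' : u \in tverts H' by rewrite !inE uv uH.
have cardP : #|P| <= d.+1.
  rewrite cardsU1; have := contractible_red_degree cH uH'; rewrite /red_degree.
  by case: (u \notin _) => //= le_d; rewrite ?add1n ?ltnS // (leq_trans le_d).
(* A part joined to [u] by a black or absent edge sees [x] and [x'] alike, so a separating vertex
   lies in [u] itself or in a red neighbour of [u]. *)
have sub : [set trace G S v0 | v0 in [set v0 | G v0 x != G v0 x']] \subset
    \bigcup_(p in P) [set trace G S v | v in [set v | rep' v == p]].
  apply/subsetP => _ /imsetP[z + ->]; rewrite inE => zx.
  apply/bigcupP; exists (rep' z); last by apply/imsetP; exists z; rewrite ?inE.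
  rewrite in_setU1; have [//|zu] := boolP (rep' z == u).
  case: qH' => repH' hom; rewrite orFb in_set repH' andTb.
  have := hom x z; have := hom x' z; rewrite x_u x'_u eq_sym zu => /(_ isT) + /(_ isT).
  move: zx; rewrite (adj_sym G z x) (adj_sym G z x').
  by case: (tedge _ _ _); case: (G x z); case: (G x' z).
apply: leq_trans (subset_leq_card sub) _.
apply: leq_trans (leq_card_bigcup _ _) _.
apply: (@leq_trans (\sum_(p in P) 2 ^ d.+2)); last first.
  by rewrite sum_nat_const leq_mul2r cardP orbT.
apply: leq_sum => p pP; apply: card_traces_of_part qH' _ injS'.
apply: contractible_red_degree cH _.
by move: pP; rewrite !inE => /orP[/eqP->|/andP[]] //; rewrite uv.
Qed.

(** Induction on the size of [S], deleting [x'] from a close pair: the vertices separating [x] from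
    [x'] have at most [B] traces, and the traces of the others are already counted on [S :\ x']. *)
Lemma card_traces_le n (G : sgraph n) d (S : {set 'I_n}) :
  twin_width_le G d -> #|traces G S| <= d.+1 * 2 ^ d.+2 * #|S| + 1.
Proof.
move=> twG; set B := _ * 2 ^ _.
have B1 : 0 < B by rewrite muln_gt0 expn_gt0.
elim/ltn_ind: {S}_.-1 {-2}S (erefl #|S|.-1) => k IH S Sk.
have [S1|S1] := leqP #|S| 1.
  apply: (@leq_trans (2 ^ #|S|)); last by case: #|S| S1 => [|[|]] //; lia.
  rewrite -card_powerset; apply: subset_leq_card.
  apply/subsetP => _ /imsetP[v _ ->]; rewrite powersetE.
  by apply/subsetP => y; rewrite inE => /andP[].
have qG : quotient_trigraph G (trigraph_of G) id.
  by split=> [a|a b _] /=; rewrite ?inE //; case: (G a b).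
have [x [x' [xS x'S xx' close]]] :=
  exists_close_pair twG qG (fun _ _ _ _ => id) S1.
have cardS : #|S| = #|S :\ x'|.+1 by rewrite (cardsD1 x') x'S.
have {IH} IH : #|traces G (S :\ x')| <= B * #|S :\ x'| + 1.
  by apply: IH (erefl _); lia.
set A := [set v | G v x != G v x'] in close.
have split_traces : traces G S \subset
    [set trace G S v | v in A] :|: [set trace G S v | v in ~: A].
  apply/subsetP => _ /imsetP[v _ ->]; rewrite inE.
  by have [vA|vA] := boolP (v \in A); apply/orP; [left|right];
    apply/imsetP; exists v; rewrite // inE.
(* Off [A], a trace contains [x'] exactly when it contains [x], so removing [x'] loses no
   information. *)
have injD : {in [set trace G S v | v in ~: A] &, injective (fun T => T :\ x')}.
  move=> _ _ /imsetP[v] + -> /imsetP[v'] + -> /setP e.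
  rewrite !inE !negbK => /eqP vx /eqP v'x; apply/setP => y.
  have := e y; rewrite !inE; have [->|//] := eqVneq y x'.
  by have := e x; rewrite !inE xx' xS x'S /= vx v'x.
have le2 : #|[set trace G S v | v in ~: A]| <= #|traces G (S :\ x')|.
  rewrite -(card_in_imset injD); apply: subset_leq_card.
  apply/subsetP => _ /imsetP[_ /imsetP[v _ ->] ->].
  apply/imsetP; exists v => //; apply/setP => y.
  by rewrite !inE andbA.
have := subset_leq_card split_traces.
have := leq_card_setU [set trace G S v | v in A] [set trace G S v | v in ~: A].
move=> [le1 _] le0; rewrite cardS mulnS -addnA.
exact: leq_trans le0 (leq_trans le1 (leq_add close (leq_trans le2 IH))).
Qed.

(** * Sorting the rows by random columns *)

Definition adjn n (G : sgraph n) (x y : nat) : bool :=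
  if (insub x, insub y) is (Some u, Some v) then G u v else false.

Lemma adjnE n (G : sgraph n) (u v : 'I_n) : adjn G u v = G u v.
Proof. by rewrite /adjn !valK. Qed.

Lemma adjn_sym n (G : sgraph n) : symmetric (adjn G).
Proof.
by move=> x y; rewrite /adjn; case: insub => [u|]; case: insub => [v|] //; exact: adj_sym.
Qed.

Lemma input_memE n (G : sgraph n) x y : x < n -> y < n ->
  input_mem G (x * n + y) = adjn G x y.
Proof.
move=> xn yn; rewrite (adjnE G (Ordinal xn) (Ordinal yn)); congr nat_of_bool.
apply/existsP/idP => [[u /existsP[v /andP[/eqP e Guv]]]|Gxy]; last first.
  by exists (Ordinal xn); apply/existsP; exists (Ordinal yn); rewrite eqxx.
have /= e1 := congr1 (divn^~ n) e; have /= e2 := congr1 (modn^~ n) e.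
move: e1 e2; rewrite !divnMDl ?(leq_trans _ xn) // !divn_small // !addn0.
rewrite !modnMDl !modn_small // => e1 e2.
have -> : Ordinal xn = u by apply: val_inj.
by have -> : Ordinal yn = v by apply: val_inj.
Qed.

Section Radix.
Variables (n : nat) (G : sgraph n).

Definition pass (s : seq nat) (c : nat) : seq nat :=
  [seq x <- s | ~~ adjn G x c] ++ [seq x <- s | adjn G x c].

Definition radix (cols : seq nat) : seq nat := foldl pass (iota 0 n) cols.

Lemma perm_pass s c : perm_eq (pass s c) s.
Proof. by rewrite /pass perm_catC perm_filterC. Qed.

Lemma perm_passes s cols : perm_eq (foldl pass s cols) s.
Proof.
elim: cols s => //= c cols IH s.
exact: perm_trans (IH _) (perm_pass _ _).
Qed.

Lemma perm_radix cols : perm_eq (radix cols) (iota 0 n).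
Proof. exact: perm_passes. Qed.

(* The last column of [cols] is the most significant one. *)
Fixpoint key (b : pred nat) (cols : seq nat) : nat :=
  if cols is c :: cols' then key b cols' * 2 + b c else 0.

Definition rkey (cols : seq nat) (x : nat) : nat := key (adjn G x) cols.

Lemma key_rcons b cols c : key b (rcons cols c) = b c * 2 ^ size cols + key b cols.
Proof. elim: cols => [|d cols IH] /=; rewrite ?IH ?expnS; lia. Qed.

Lemma key_lt b cols : key b cols < 2 ^ size cols.
Proof. elim: cols => //= c cols IH; rewrite expnS; case: (b c); lia. Qed.

Lemma eq_key b b' cols : {in cols, b =1 b'} -> key b cols = key b' cols.
Proof.
elim: cols => //= c cols IH e; rewrite e ?mem_head // IH // => z zc.
by apply: e; rewrite inE zc orbT.
Qed.

Lemma key_inj b b' cols : key b cols = key b' cols -> {in cols, b =1 b'}.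
Proof.
elim: cols => //= c cols IH e z; rewrite inE => /orP[/eqP->|].
  by move: e; case: (b c); case: (b' c); lia.
by apply: IH; move: e; case: (b c); case: (b' c); lia.
Qed.

(** Least-significant-digit radix sort: the last partition decides the top bit and, being stable,
    keeps the earlier order inside each half. The start [s] is arbitrary so that the last passes can
    be studied alone, on the list left by the first ones. *)
Lemma passes_sorted s cols :
  pairwise (fun x y => rkey cols x <= rkey cols y) (foldl pass s cols).
Proof.
elim/last_ind: cols => [|cols c IH].
  by rewrite /rkey /=; elim: s => //= x s ->; rewrite andbT; apply/allP.
rewrite -cats1 foldl_cat /= cats1 pairwise_cat; apply/and3P; split.
- apply/allrelP => x y; rewrite !mem_filter => /andP[/negPf xc _] /andP[yc _].
  rewrite /rkey !key_rcons xc yc; have := key_lt (adjn G x) cols; lia.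
- apply: (sub_in_pairwise (P := fun x => ~~ adjn G x c)) (filter_all _ _)
    (pairwise_filter _ IH) => x y /negPf xc /negPf yc.
  by rewrite /rkey !key_rcons xc yc.
apply: (sub_in_pairwise (P := fun x => adjn G x c)) (filter_all _ _)
  (pairwise_filter _ IH) => x y xc yc.
by rewrite /rkey !key_rcons [adjn G x c]xc [adjn G y c]yc /= leq_add2l.
Qed.

Definition breaks (T : eqType) (f : nat -> T) (s : seq nat) : nat :=
  \sum_(i < (size s).-1) (f (nth 0 s i) != f (nth 0 s i.+1)).

(** In a sorted list a value never returns once it has been left, so each break brings a new
    value. *)
Lemma breaks_sorted (f : nat -> nat) s :
  pairwise (fun x y => f x <= f y) s -> s != [::] ->
  breaks f s < size (undup (map f s)).
Proof.
rewrite /breaks; elim: s => // x [|y s] IH; first by rewrite big_ord0.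
rewrite [pairwise _ _]/= => /andP[/andP[xy xs] ps] _.
have {}IH := IH ps isT; rewrite big_ord_recl /=.
have [e|ne] := eqVneq (f x) (f y); first by rewrite e mem_head.
have xN : f x \notin map f (y :: s).
  apply/negP => /mapP[z]; rewrite inE => /orP[/eqP->/eqP|zs fz]; first by rewrite (negPf ne).
  have := allP (proj1 (andP ps)) z zs; rewrite -fz => yx.
  by move: ne; rewrite eqn_leq xy yx.
rewrite /= in xN; rewrite (negPf xN) /= -[X in _ < X]/((size _).+1).
rewrite add1n ltnS; exact: IH.
Qed.

Definition hdist (x y : nat) : nat :=
  \sum_(c < n) (adjn G x c != adjn G y c).

Lemma hdist_le x y : hdist x y <= n.
Proof.
rewrite -[X in _ <= X]card_ord -sum1_card; apply: leq_sum => i _; exact: leq_b1.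
Qed.

(** The last [l] passes sort by the key on [l] columns, whatever came before, and a key is
    determined by the trace on these columns. The strict inequality of [breaks_sorted] absorbs the +
    1 of [card_traces_le]; repeated columns only make [S] smaller. *)
Lemma breaks_radix d cols l :
  twin_width_le G d -> 0 < n -> all (fun c => c < n) cols -> l <= size cols ->
  breaks (rkey (drop (size cols - l) cols)) (radix cols) <= d.+1 * 2 ^ d.+2 * l.
Proof.
move=> twG n0 /allP cn lN; set suf := drop _ cols.
have sl : size suf = l by rewrite size_drop subKn.
have rE : radix cols = foldl pass (foldl pass (iota 0 n) (take (size cols - l) cols)) suf.
  by rewrite -foldl_cat cat_take_drop.
have ss : pairwise (fun x y => rkey suf x <= rkey suf y) (radix cols).
  by rewrite rE; apply: passes_sorted.
have r0 : radix cols != [::].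
  by rewrite -size_eq0 (perm_size (perm_radix cols)) size_iota -lt0n.
rewrite -ltnS; apply: leq_trans (breaks_sorted ss r0) _.
set S := [set c : 'I_n | val c \in suf].
have cS : #|S| <= l.
  rewrite -sl cardE -(size_map val); apply: uniq_leq_size.
    by rewrite map_inj_uniq ?enum_uniq //; apply: val_inj.
  by move=> _ /mapP[c + ->]; rewrite mem_enum inE.
have tr := card_traces_le S twG.
apply: (@leq_trans #|traces G S|); last first.
  by apply: leq_trans tr _; rewrite addn1 ltnS leq_mul2l cS orbT.
rewrite cardE -(size_map (fun T : {set 'I_n} =>
  key (fun c => if insub c is Some c' then c' \in T else false) suf)).
apply: uniq_leq_size; first exact: undup_uniq.
move=> k; rewrite mem_undup => /mapP[x + ->].
rewrite (perm_mem (perm_radix cols)) mem_iota add0n /= => xn.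
apply/mapP; exists (trace G S (Ordinal xn)).
  by rewrite mem_enum; apply/imsetP; exists (Ordinal xn).
apply: eq_key => c cs; have cn' : c < n by apply: cn; apply: mem_drop cs.
by rewrite insubT /= !inE cs /= -adjnE.
Qed.

(** The window is inversely proportional to the distance: a uniform column separates the two rows
    with probability D/n, so N/D columns with N = a n log n contain about a log n separating ones on
    average. *)
Definition separating (cols : seq nat) : Prop :=
  forall x y, x < n -> y < n -> 0 < hdist x y ->
    ~~ all (fun c => adjn G x c == adjn G y c)
        (drop (size cols - size cols %/ hdist x y) cols).

Lemma dyadic_sum_ge D L : D <= 2 ^ L -> D <= \sum_(j < L.+1) (2 ^ j <= D) * 2 ^ j.
Proof.
have full k : \sum_(j < k) 2 ^ j = (2 ^ k).-1.
  elim: k => [|k IH]; rewrite ?big_ord0 // big_ord_recr /= IH expnS.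
  by have := expn_gt0 2 k; lia.
move=> DL; case: (posnP D) => [->//|D0].
have [lo hi] := andP (trunc_log_bounds (isT : 1 < 2) D0).
set t := trunc_log 2 D in lo hi.
have tL : t.+1 <= L.+1 by rewrite ltnS -(leq_exp2l (m := 2)) // (leq_trans lo).
apply: (@leq_trans (\sum_(j < t.+1) 2 ^ j)).
  by rewrite full; move: hi; lia.
rewrite (big_ord_widen _ (fun j => 2 ^ j) tL) big_mkcond /=.
apply: leq_sum => j _; case: ltnP => // jt.
by rewrite (leq_trans _ lo) ?mul1n // leq_exp2l.
Qed.

(** At scale 2^j, a consecutive pair at distance at least 2^j differs on the last N/2^j columns,
    hence is a break of their key. There are at most B N/2^j such breaks, each of weight 2^j: every
    scale contributes at most B N. *)
Lemma sum_breaks_radix d cols L :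
  twin_width_le G d -> 0 < n -> n <= 2 ^ L -> all (fun c => c < n) cols ->
  separating cols ->
  \sum_(x < n) breaks (adjn G x) (radix cols)
    <= L.+1 * (d.+1 * 2 ^ d.+2 * size cols).
Proof.
move=> twG n0 nL cn sep; set B := _ * 2 ^ d.+2; set N := size cols; set s := radix cols.
have sz : size s = n by rewrite (perm_size (perm_radix cols)) size_iota.
have sn i : i < n -> nth 0 s i < n.
  by move=> ni; have := mem_nth 0 (_ : i < size s); rewrite sz => /(_ ni);
    rewrite (perm_mem (perm_radix cols)) mem_iota.
pose D i := hdist (nth 0 s i) (nth 0 s i.+1).
(* Double counting, using the symmetry of adjacency: a break of row [x] between two consecutive
   positions is a coordinate [x] in which the rows of the vertices at these positions differ. *)
have -> : \sum_(x < n) breaks (adjn G x) s = \sum_(i < n.-1) D i.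
  rewrite /breaks sz exchange_big; apply: eq_bigr => i _; apply: eq_bigr => x _.
  by rewrite !(adjn_sym G x).
apply: (@leq_trans (\sum_(i < n.-1) \sum_(j < L.+1) (2 ^ j <= D i) * 2 ^ j)).
  by apply: leq_sum => i _; apply: dyadic_sum_ge; apply: leq_trans (hdist_le _ _) nL.
rewrite exchange_big /=; apply: (@leq_trans (\sum_(j < L.+1) B * N)); last first.
  by rewrite sum_nat_const card_ord.
apply: leq_sum => j _; rewrite -big_distrl /=.
have lN : N %/ 2 ^ j <= N by apply: leq_div.
apply: (@leq_trans (B * (N %/ 2 ^ j) * 2 ^ j)); last first.
  by rewrite -mulnA leq_mul2l leq_divM orbT.
rewrite leq_mul2r; apply/orP; right.
apply: leq_trans (breaks_radix twG n0 cn lN); rewrite /breaks -/s sz.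
apply: leq_sum => i _; case: (leqP (2 ^ j) (D i)) => //= Dj.
case: (rkey _ _ =P rkey _ _) => //= /key_inj same; exfalso.
have ni : i.+1 < n by case: i {Dj same} => i /=; lia.
have D0 : 0 < D i by rewrite (leq_trans _ Dj) ?expn_gt0.
have /negP := sep _ _ (sn i (ltnW ni)) (sn i.+1 ni) D0; apply; apply/allP => c cs.
apply/eqP/same; move: cs; rewrite -/N.
(* The window belonging to the actual distance is contained in the wider window belonging to 2^j. *)
have le_q : N %/ hdist (nth 0 s i) (nth 0 s i.+1) <= N %/ 2 ^ j.
  by apply: leq_div2l; rewrite ?expn_gt0.
have -> : N - N %/ hdist (nth 0 s i) (nth 0 s i.+1) =
   (N %/ 2 ^ j - N %/ hdist (nth 0 s i) (nth 0 s i.+1)) + (N - N %/ 2 ^ j) by lia.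
by rewrite -drop_drop; apply: mem_drop.
Qed.

End Radix.

(** * Probability of separation *)

Section Sampling.
Variables (n : nat) (G : sgraph n) (w T : nat).
Hypothesis n1 : 1 < n.
Hypothesis wn : 2 * n <= 2 ^ w.

Definition sampled_columns (N : nat) (tp : nat -> nat) : seq nat :=
  mkseq (fun i => tp i %% n) N.

Definition agree (x y : nat) : {set 'I_(2 ^ w)} :=
  [set r : 'I_(2 ^ w) | adjn G x (r %% n) == adjn G y (r %% n)].

(** Reduction modulo [n] is not uniform, but every residue has at least [q] preimages and 2^w <= 2 n
    q by [wn]. A random word thus separates the rows with probability at least D/(2n); the factor 2
    is the price of the bias. *)
Lemma card_agree x y : #|agree x y| * (2 * n) + hdist G x y * 2 ^ w <= 2 ^ w * (2 * n).
Proof.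
set q := 2 ^ w %/ n; set D := hdist G x y.
have n0 : 0 < n by lia.
have bound (c : 'I_n) (k : 'I_q) : k * n + c < 2 ^ w.
  have := ltn_ord k; have := ltn_ord c; have := leq_divM (2 ^ w) n; rewrite -/q.
  move=> h1 h2 h3; apply: (@leq_trans (k.+1 * n)); first by rewrite mulSn; lia.
  by apply: leq_trans h1; rewrite leq_mul2r h3 orbT.
pose Df := [set c : 'I_n | adjn G x c != adjn G y c].
have DE : D = #|Df|.
  rewrite -sum1_card [RHS]big_mkcond; apply: eq_bigr => c _.
  by rewrite inE; case: (_ != _).
pose f (u : 'I_n * 'I_q) : 'I_(2 ^ w) := Ordinal (bound u.1 u.2).
have fmod u : f u %% n = u.1 by rewrite /= modnMDl modn_small.
have fdiv u : f u %/ n = u.2 by rewrite /= divnMDl // divn_small ?addn0.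
have injf : injective f.
  move=> [c k] [c' k'] e; have := fmod (c, k); have := fdiv (c, k).
  by rewrite e fmod fdiv /= => /val_inj -> /val_inj ->.
have le1 : D * q <= #|~: agree x y|.
  rewrite DE -[q in X in X <= _]card_ord -cardsT -cardsX -(card_imset _ injf).
  apply: subset_leq_card; apply/subsetP => _ /imsetP[u + ->].
  by rewrite !inE fmod andbT.
have := cardsC (agree x y); rewrite card_ord => tot.
have q2 : 2 ^ w <= q * (2 * n).
  have := divn_eq (2 ^ w) n; have := ltn_pmod (2 ^ w) n0; rewrite -/q; lia.
have : D * 2 ^ w <= D * q * (2 * n) by rewrite -mulnA leq_mul2l q2 orbT.
have : D * q * (2 * n) <= #|~: agree x y| * (2 * n) by rewrite leq_mul2r le1 orbT.
by rewrite -[in X in _ -> _ -> _ <= X]tot mulnDl; lia.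
Qed.

Variables (R : realType) (c : R) (a : nat).
Hypothesis hc : (0 < c)%R.
Hypothesis ha : (4 * (c + 2) <= a%:R)%R.

Let N := a * (n * up_log 2 n).
Hypothesis NT : N <= T.

Let tapes := {ffun 'I_T -> 'I_(2 ^ w)}.

Definition unseparated (u v : 'I_n) : {set tapes} :=
  [set o : tapes | all (fun c => adjn G u c == adjn G v c)
     (drop (N - N %/ hdist G u v) (sampled_columns N (tape_of o)))].

(** The bad tapes lie in a product set: the [l] words at places N - l to N - 1 are confined to
    [agree u v], and the other T - l words are free. *)
Lemma card_unseparated (u v : 'I_n) (l := N %/ hdist G u v) :
  #|unseparated u v| <= #|agree u v| ^ l * (2 ^ w) ^ (T - l).
Proof.
have lN : l <= N by apply: leq_div.
pose F (i : 'I_T) : pred 'I_(2 ^ w) :=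
  fun r => (N - l <= i < N) ==> (r \in agree u v).
apply: (@leq_trans #|family F|).
  apply: subset_leq_card; apply/subsetP => o; rewrite inE -/l => /allP h.
  apply/familyP => i; rewrite unfold_in; apply/implyP => /andP[i1 i2].
  rewrite inE; apply: h; rewrite -[X in X \in _](_ : nth 0 (drop (N - l) (sampled_columns N (tape_of o))) (i - (N - l)) = _).
    by apply: mem_nth; rewrite size_drop size_mkseq; lia.
  by rewrite nth_drop subnKC // nth_mkseq // /tape_of valK.
rewrite card_family -[foldr _ _ _](_ : \prod_(i < T) #|F i| = _); last first.
  by rewrite unlock /reducebig /= foldr_map; congr foldr; rewrite ?enumT.
rewrite (bigID (fun i : 'I_T => N - l <= i < N)) /=.
have cnt : #|[pred i : 'I_T | N - l <= i < N]| = l.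
  have := sum_nat_const_nat (N - l) N 1; rewrite subKn // muln1 => sl.
  rewrite -[RHS]sl (big_nat_widen _ _ _ _ _ NT) big_geq_mkord -sum1_card.
  by apply: eq_bigl => i; rewrite inE /= andbC.
have cntC : #|[pred i : 'I_T | ~~ (N - l <= i < N)]| = T - l.
  by have := cardC [pred i : 'I_T | N - l <= i < N]; rewrite cnt card_ord => /(canRL (addKn _)).
rewrite (eq_bigr (fun=> #|agree u v|)); last first.
  by move=> i hi; apply: eq_card => r; rewrite unfold_in /F hi.
rewrite [X in _ * X](eq_bigr (fun=> 2 ^ w)); last first.
  by move=> i /negPf hi; rewrite -[RHS]card_ord; apply: eq_card => r; rewrite unfold_in /F hi.
by rewrite !prod_nat_const cnt cntC.
Qed.

Lemma card_tapes : #|{: tapes}| = (2 ^ w) ^ T.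
Proof. by rewrite card_ffun !card_ord. Qed.

(** Each of the [l] draws fails with probability at most exp(-D/(2n)), and D l >= N/2, so all fail
    with probability at most exp(-N/(4n)). The 4 in [ha] is the factor 2 of the bias times the
    factor 2 of the rounding in [l]. *)
Lemma prob_unseparated (u v : 'I_n) : 0 < hdist G u v ->
  (#|unseparated u v|%:R / #|{: tapes}|%:R <= expR (- (c + 2) * ln n%:R) :> R)%R.
Proof.
move=> D0; set D := hdist G u v; set l := N %/ D.
have lT : l <= T by apply: leq_trans NT; apply: leq_div.
have n0 : (0 < n%:R :> R)%R by rewrite ltr0n; lia.
have W0 : (0 < (2 ^ w)%:R :> R)%R by rewrite ltr0n expn_gt0.
have L0 : 0 < up_log 2 n by rewrite up_log_gt0.
have a8 : (8 < a%:R :> R)%R by move: hc ha; lra.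

have a0 : 0 < a by rewrite -(ltr0n R); lra.
(* From n <= 2 ^ up_log 2 n and 2 <= e. *)
have lnL : (ln (n%:R : R) <= (up_log 2 n)%:R)%R.
  rewrite -[X in (_ <= X)%R]expRK ler_ln ?posrE ?expR_gt0 //.
  apply: (@le_trans _ _ ((2 ^ up_log 2 n)%:R)%R).
    by rewrite ler_nat up_logP.
  rewrite natrX -[X in expR X]mulr1 expRM_natl lerXn2r ?nnegrE ?expR_ge0 //.
  by have := expR_ge1Dx (1 : R)%R; rewrite (_ : 1 + 1 = 2 :> R)%R.
have ratio : (#|agree u v|%:R / (2 ^ w)%:R <= expR (- (D%:R / (2 * n%:R))) :> R)%R.
  apply: le_trans (expR_ge1Dx _).
  rewrite ler_pdivrMr // mulrBl mul1r lerBrDr.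
  have := card_agree u v; rewrite -(ler_nat R) -/D natrD !natrM => h.
  have n2 : (0 < 2 * n%:R :> R)%R by lra.
  rewrite -(ler_pM2r n2) mulrDl; apply: le_trans h.
  rewrite lerD2l le_eqVlt; apply/orP; left; apply/eqP; field.
  by apply: lt0r_neq0.
(* Rounding down loses at most a factor 2 once l >= 1, which holds because D <= n <= N. *)
have Dl : (N%:R <= 2 * (D * l)%:R :> R)%R.
  rewrite -natrM ler_nat.
  have := divn_eq N D; have := ltn_pmod N D0; rewrite -/l -/D => h1 h2.
  have : 0 < l.
    rewrite divn_gt0 //; apply: leq_trans (hdist_le _ _ _) _; rewrite /N.
    by rewrite mulnCA leq_pmulr // muln_gt0 a0.
  by move: h1; rewrite [in X in _ -> _ -> is_true (X <= _)]h2 => h1 l0; nia.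
apply: (@le_trans _ _ ((#|agree u v|%:R / (2 ^ w)%:R) ^+ l)%R).
  rewrite ler_pdivrMr; last by rewrite card_tapes ltr0n !expn_gt0.
  have TE : (2 ^ w) ^ T = (2 ^ w) ^ l * (2 ^ w) ^ (T - l) by rewrite -expnD subnKC.
  rewrite card_tapes TE natrM mulrA [((2 ^ w) ^ l)%:R%R]natrX expr_div_n divfK.
    by rewrite -natrX -natrM ler_nat; apply: card_unseparated.
  by rewrite expf_neq0 // lt0r_neq0.
apply: (@le_trans _ _ (expR (- (D%:R / (2 * n%:R))) ^+ l)%R).
  by rewrite lerXn2r // ?nnegrE ?expR_ge0 // divr_ge0.
rewrite -expRM_natl ler_expR mulrN !mulNr lerN2.
apply: (@le_trans _ _ ((c + 2) * (up_log 2 n)%:R)%R).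
  by rewrite ler_wpM2l //; move: hc; lra.
apply: (@le_trans _ _ (N%:R / (4 * n%:R))%R).
  rewrite /N !natrM ler_pdivlMr; last by lra.
  have := ler_wpM2r (_ : 0 <= n%:R * (up_log 2 n)%:R :> R)%R ha.
  rewrite mulr_ge0 // => /(_ isT); lra.
rewrite ler_pdivrMr; last by lra.
have -> : (l%:R * (D%:R / (2 * n%:R)) * (4 * n%:R) = 2 * (D * l)%:R :> R)%R.
  by rewrite natrM; field; apply: lt0r_neq0.
exact: Dl.
Qed.

(** Union bound over at most n^2 pairs, which turns n^{-(c+2)} into n^{-c}. Any event implied by
    separation is allowed as [good], in particular that of a timely correct run. *)
Lemma prob_separating (good : {set tapes}) :
  (forall o : tapes, separating G (sampled_columns N (tape_of o)) -> o \in good) ->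
  (1 - n%:R `^ (- c) <= #|good|%:R / #|{: tapes}|%:R :> R)%R.
Proof.
move=> sep_good.
have n0 : (0 < n%:R :> R)%R by rewrite ltr0n; lia.
have t0 : (0 < #|{: tapes}|%:R :> R)%R by rewrite card_tapes ltr0n !expn_gt0.
have bad_le : #|~: good| <=
    \sum_(p : 'I_n * 'I_n | 0 < hdist G p.1 p.2) #|unseparated p.1 p.2|.
  have sub : ~: good \subset
      \bigcup_(p in [set p : 'I_n * 'I_n | 0 < hdist G p.1 p.2]) unseparated p.1 p.2.
    apply/subsetP => o; rewrite inE; apply: contraR => /bigcupP ex.
    apply: sep_good => x y xn yn D0; apply/negP => h; apply: ex.
    exists (Ordinal xn, Ordinal yn); rewrite ?inE //=.
    by move: h; rewrite size_mkseq.
  apply: leq_trans (subset_leq_card sub) _; apply: leq_trans (leq_card_bigcup _ _) _.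
  by rewrite (eq_bigl (fun p : 'I_n * 'I_n => 0 < hdist G p.1 p.2)) // => p; rewrite inE.
have -> : (#|good|%:R / #|{: tapes}|%:R = 1 - #|~: good|%:R / #|{: tapes}|%:R :> R)%R.
  rewrite -[in LHS](setCK good) cardsCs setCK natrB ?max_card //.
  by rewrite mulrBl divff ?lt0r_neq0.
rewrite lerD2l lerN2 ler_pdivrMr //.
apply: (@le_trans _ _ (\sum_(p : 'I_n * 'I_n | (0 < hdist G p.1 p.2)%N)
    (expR (- (c + 2) * ln n%:R) * #|{: tapes}|%:R))%R).
  apply: le_trans (_ : (_ <= (\sum_(p : 'I_n * 'I_n | (0 < hdist G p.1 p.2)%N)
     #|unseparated p.1 p.2|)%:R)%R) _; first by rewrite ler_nat.
  rewrite natr_sum; apply: ler_sum => p D0.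
  by rewrite -ler_pdivrMr //; apply: prob_unseparated.
set K := (_ * #|{: tapes}|%:R)%R.
have K0 : (0 <= K)%R by rewrite mulr_ge0 ?expR_ge0.
apply: (@le_trans _ _ (\sum_(p : 'I_n * 'I_n) K)%R).
  by rewrite [leRHS](bigID (fun p : 'I_n * 'I_n => 0 < hdist G p.1 p.2)) /= lerDl sumr_ge0.
rewrite sumr_const card_prod card_ord -[(K *+ _)%R]mulr_natr /K mulrAC ler_pM2r //.
rewrite /powR (negPf (lt0r_neq0 n0)) natrM.
have nE : (n%:R = expR (ln n%:R) :> R)%R by rewrite lnK.
by rewrite {2 3}nE -!expRD ler_expR; lra.
Qed.
End Sampling.

(** * A program logic with running times *)

(** Total correctness, with the exact running time handed to the postcondition. *)
Definition run (w : nat) (c : cmd) (s : state) (Q : state -> nat -> Prop) : Prop :=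
  exists t s', exec w c s t s' /\ Q s' t.

Fixpoint evn (s : state) (e : expr) : nat :=
  match e with
  | Cst a => a
  | Reg r => regs s r
  | Fetch e1 => memory s (evn s e1)
  | Bin o e1 e2 => eval_binop o (evn s e1) (evn s e2)
  end.

(** Absence of overflow in every subexpression, so that the machine value is the value [evn] in
    unbounded arithmetic. Registers and cells need no condition, since they are read without
    reduction. *)
Fixpoint fits (B : nat) (s : state) (e : expr) : Prop :=
  match e with
  | Cst a => a < B
  | Reg r => True
  | Fetch e1 => fits B s e1
  | Bin o e1 e2 =>
      [/\ fits B s e1, fits B s e2 & eval_binop o (evn s e1) (evn s e2) < B]
  end.

Section Logic.
Variable w : nat.
Implicit Types (c : cmd) (s : state) (e : expr) (Q : state -> nat -> Prop).

Lemma eval_fits s e : fits (2 ^ w) s e -> eval w s e = evn s e.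
Proof.
elim: e => //= [a ?|e1 IH /IH ->|o e1 IH1 e2 IH2 [/IH1 -> /IH2 -> ?]] //;
  by rewrite modn_small.
Qed.

Lemma run_weaken c s Q Q' :
  run w c s Q -> (forall s' t, Q s' t -> Q' s' t) -> run w c s Q'.
Proof. by move=> [t [s' [ex q]]] QQ'; exists t, s'; split; auto. Qed.

Lemma run_skip s Q : Q s 1 -> run w Skip s Q.
Proof. by exists 1, s; split; first exact: exec_skip. Qed.

Lemma run_assign s r e Q : fits (2 ^ w) s e ->
  Q (State (upd (regs s) r (evn s e)) (memory s) (tape s)) (ecost e).+1 ->
  run w (Assign r e) s Q.
Proof.
move=> /eval_fits <- q; exists (ecost e).+1.
by eexists; split; [exact: exec_assign|].
Qed.

Lemma run_rand s r Q :
  Q (State (upd (regs s) r (tape s 0)) (memory s) (fun i => tape s i.+1)) 1 ->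
  run w (Rand r) s Q.
Proof. by move=> q; exists 1; eexists; split; [exact: exec_rand|]. Qed.

Lemma run_store s e1 e2 Q : fits (2 ^ w) s e1 -> fits (2 ^ w) s e2 ->
  Q (State (regs s) (upd (memory s) (evn s e1) (evn s e2)) (tape s))
    (ecost e1 + ecost e2).+1 ->
  run w (Store e1 e2) s Q.
Proof.
move=> /eval_fits <- /eval_fits <- q; exists (ecost e1 + ecost e2).+1.
by eexists; split; [exact: exec_store|].
Qed.

Lemma run_seq c1 c2 s Q :
  run w c1 s (fun s1 t1 => run w c2 s1 (fun s2 t2 => Q s2 (t1 + t2).+1)) ->
  run w (Seq c1 c2) s Q.
Proof.
move=> [t1 [s1 [ex1 [t2 [s2 [ex2 q]]]]]]; exists (t1 + t2).+1, s2.
by split=> //; apply: exec_seq ex1 ex2.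
Qed.

Lemma run_if s e c1 c2 Q : fits (2 ^ w) s e ->
  run w (if evn s e != 0 then c1 else c2) s (fun s' t => Q s' (ecost e + t).+1) ->
  run w (If e c1 c2) s Q.
Proof.
move=> /eval_fits <- [t [s' [ex q]]]; exists (ecost e + t).+1, s'.
by split=> //; apply: exec_if.
Qed.

Lemma run_while (T : Type) (I : T -> state -> Prop) (pot : T -> state -> nat)
    e c g s :
  (forall g s, I g s -> fits (2 ^ w) s e) ->
  (forall g s, I g s -> evn s e <> 0 -> run w c s (fun s' t =>
     exists2 g', I g' s' & (t + ecost e).+1 + pot g' s' <= pot g s)) ->
  I g s ->
  run w (While e c) s (fun s' t =>
    exists2 g', I g' s' & evn s' e = 0 /\ t + pot g' s' <= pot g s + (ecost e).+1).
Proof.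
move=> fe step.
move: {2}(pot g s).+1 (ltnSn (pot g s)) => k; elim: k g s => // k IH g s lt_k Ig.
have := eval_fits (fe _ _ Ig); case: (evn s e =P 0) => [e0|e0] ev.
  exists (ecost e).+1, s; split; first by apply: exec_while_stop; rewrite ev.
  by exists g => //; split=> //; rewrite addnC.
have [t1 [s1 [ex1 [g1 I1 le1]]]] := step _ _ Ig e0.
have [|t2 [s2 [ex2 [g2 I2 [e2 le2]]]]] := IH g1 s1 _ I1; first by lia.
exists (ecost e + t1 + t2).+1, s2; split.
  by apply: exec_while_loop ex1 ex2; rewrite ev.
by exists g2 => //; split=> //; lia.
Qed.

Definition for_loop (r : nat) (e : expr) (body : cmd) : cmd :=
  While (Bin OLt (Reg r) e) (Seq body (Assign r (Bin OAdd (Reg r) (Cst 1)))).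

(** The overhead 8 per round consists of 4 units for the increment, 1 for [Seq], 2 for the
    comparison around [e] and 1 for [While]. *)
Lemma run_for (I : nat -> state -> Prop) N C r e body i s Q :
  N < 2 ^ w -> 1 < 2 ^ w -> i <= N ->
  (forall i s, I i s -> [/\ regs s r = i, fits (2 ^ w) s e & evn s e = N]) ->
  (forall i s, i < N -> I i s -> run w body s (fun s' t =>
     [/\ t + ecost e + 8 <= C, regs s' r = i
       & I i.+1 (State (upd (regs s') r i.+1) (memory s') (tape s'))])) ->
  I i s ->
  (forall s' t, I N s' -> t <= (N - i) * C + ecost e + 3 -> Q s' t) ->
  run w (for_loop r e body) s Q.
Proof.
move=> NB B1 iN Ir step Ii post.
pose I' (j : nat) s := j <= N /\ I j s; pose pot (j : nat) (_ : state) := (N - j) * C.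
apply: run_weaken; first apply: (@run_while nat I' pot _ _ i s).
- move=> j s' [_ Ij] /=; have [-> fe ->] := Ir _ _ Ij; split=> //.
  by case: (j < N) => /=; lia.
- move=> j s' [jN Ij] /=; have [rj fe ->] := Ir _ _ Ij; rewrite rj => ne.
  have {}jN : j < N by move: ne; case: (j < N).
  apply: run_seq; apply: run_weaken (step _ _ jN Ij) _ => s1 t1 [le1 r1 I1].
  apply: run_assign; first by rewrite /= r1; split=> //; lia.
  exists j.+1; first by rewrite /= r1 addn1; split.
  have Nj : N - j = (N - j.+1).+1 by lia.
  by rewrite /pot Nj mulSn /=; lia.
- by [].
move=> s' t [j [jN Ij] []] /=; have [-> _ ->] := Ir _ _ Ij.
case: ltnP => // Nj _; have {jN}jN : j = N by lia.
by rewrite {}jN /pot in Ij * => le; apply: post => //; move: le; rewrite subnn; lia.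
Qed.

End Logic.

(** * Interval union-find, runs and breadth-first search *)

Lemma sum_interval m a b : a <= b -> b <= m -> \sum_(p < m) (a <= p < b) = b - a.
Proof.
move=> ab bm; have := sum_nat_const_nat a b 1; rewrite muln1 => <-.
rewrite (big_nat_widen _ _ _ _ _ bm) big_geq_mkord [RHS]big_mkcond /=.
by apply: eq_bigr => i _; rewrite andbC; case: (_ && _).
Qed.

(** * Interval union-find with relabelling of the smaller block *)

Section UnionFind.
Variable n : nat.

(* The blocks are intervals of [0, n]; a block consists of an unvisited
   position, which is its right end, and of the visited ones just before. *)
Definition uf (lab lo hi : nat -> nat) (V : pred nat) : Prop :=
  forall p, p <= n ->
  [/\ lab p <= n, lo (lab p) <= p <= hi (lab p), hi (lab p) <= n,
      forall q, lo (lab p) <= q <= hi (lab p) -> lab q = lab p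
    & (hi (lab p) == p) = ~~ V p].

(** Each position contributes the logarithm of the size of its block. A relabelled position moves to
    a block at least twice as large, so the rise of this sum pays for the relabellings. *)
Definition uf_pot (lab lo hi : nat -> nat) : nat :=
  \sum_(p < n.+1) trunc_log 2 (hi (lab p) - lo (lab p)).+1.

Lemma uf_init lab lo hi :
  (forall p, p <= n -> [/\ lab p = p, lo p = p & hi p = p]) -> uf lab lo hi pred0.
Proof.
move=> h p pn; have [lp op ip] := h p pn; rewrite lp op ip eqxx leqnn; split=> // q hq.
by have -> : q = p by lia.
Qed.

Lemma uf_pot_le lab lo hi V : uf lab lo hi V ->
  uf_pot lab lo hi <= n.+1 * trunc_log 2 n.+1.
Proof.
move=> u; rewrite -[X in X * _]card_ord -sum_nat_const; apply: leq_sum => p _.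
have [//|_ _ hn _ _] := u p _; first by rewrite -ltnS.
by apply: leq_trunc_log; lia.
Qed.

(** The find operation: the right end of the block of [p] is the first unvisited position from [p]
    on. It always exists, since the invariant forces the sentinel position [n] to be unvisited. *)
Lemma uf_next lab lo hi V p : uf lab lo hi V -> p <= n ->
  let q := hi (lab p) in
  [/\ p <= q, q <= n, ~~ V q & forall r, p <= r < q -> V r].
Proof.
move=> u pn q; have [_ /andP[lp ph] hn same _] := u p pn.
have lq : lab q = lab p by apply: same; rewrite /q; lia.
split=> //; first by have [_ _ _ _ <-] := u q hn; rewrite lq eqxx.
move=> r /andP[pr rq]; have lr : lab r = lab p by apply: same; rewrite -/q; lia.
have [|_ _ _ _] := u r _; first by lia.
by rewrite lr -/q => e; apply: negbFE; rewrite -e; lia.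
Qed.

Lemma trunc_log2_double_le a b : 0 < a -> a.*2 <= b ->
  (trunc_log 2 a).+1 <= trunc_log 2 b.
Proof. by move=> a0 ab; rewrite -trunc_log2_double //; apply: leq_trunc_log. Qed.

(** Visiting [r] joins its block, which ends at [r], to the block starting at r + 1. Their sizes are
    r - la + 1 and hb - r, so [small] says that the left one is not larger; the relabelled range
    [from, to) is always the smaller block. *)
Lemma uf_merge lab lo hi V r lab' lo' hi' :
  uf lab lo hi V -> r < n -> ~~ V r ->
  let: a := lab r in let: b := lab r.+1 in
  let: la := lo a in let: hb := hi b in
  let: small := r - la < hb - r in
  let: from := if small then la else r.+1 in
  let: to := if small then r.+1 else hb.+1 in
  let: c := if small then b else a in
  (forall p, p <= n -> lab' p = if from <= p < to then c else lab p) ->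
  (forall p, p <= n -> lo' p = if p == c then la else lo p) ->
  (forall p, p <= n -> hi' p = if p == c then hb else hi p) ->
  uf lab' lo' hi' (fun p => V p || (p == r)) /\
  uf_pot lab lo hi + (to - from) <= uf_pot lab' lo' hi'.
Proof.
move=> u rn Vr; set a := lab r; set b := lab r.+1; set la := lo a; set hb := hi b.
set small := r - la < hb - r; set from := if small then la else _.
set to := if small then _ else hb.+1; set c := if small then b else a.
have cases : [/\ small, from = la, to = r.+1 & c = b] \/
    [/\ ~~ small, from = r.+1, to = hb.+1 & c = a].
  by rewrite /from /to /c; case: (boolP small) => sm; [left|right].
clearbody from to c => labE loE hiE.
have [aN /andP[la_r _] _ sa ha] := u r (ltnW rn).
rewrite -/a -/la Vr in aN la_r sa ha; move/eqP: ha => ha; rewrite ha in sa.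
have [bN /andP[lo_b b_hi] hbN sb _] := u r.+1 rn; rewrite -/b -/hb in bN lo_b b_hi hbN sb.
(* Otherwise the block of r + 1 would contain [r], whose block ends at [r]. *)
have lbE : lo b = r.+1.
  case: (ltngtP (lo b) r.+1) lo_b => // lb _.
  have : lab r = b by apply: sb; lia.
  by rewrite -/a => ab; move: b_hi; rewrite /hb -ab ha ltnn.
rewrite lbE in sb.
have in_a p : la <= p <= r -> lab p = a by exact: sa.
have in_b p : r < p <= hb -> lab p = b by exact: sb.
have a_in p : p <= n -> lab p = a -> la <= p <= r.
  by move=> pn e; have [_ + _ _ _] := u p pn; rewrite e -/la ha.
have b_in p : p <= n -> lab p = b -> r < p <= hb.
  by move=> pn e; have [_ + _ _ _] := u p pn; rewrite e lbE -/hb.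
have cN : c <= n by case: cases => -[_ _ _ ->].
have lab'_in p : la <= p <= hb -> lab' p = c.
  move=> hp; rewrite labE; last by lia.
  case: ifP => // h; case: cases => -[_ fE tE ->].
    by apply: in_b; lia.
  by apply: in_a; lia.
have lab'_out p : p <= n -> ~~ (la <= p <= hb) -> lab' p = lab p /\ lab p != c.
  move=> pn hp; split.
    by rewrite labE //; case: ifP => // h; case: cases => -[_ fE tE _]; lia.
  apply/eqP; case: cases => -[_ _ _ ->] => [/(b_in _ pn)|/(a_in _ pn)]; lia.
have lo'c : lo' c = la by rewrite loE // eqxx.
have hi'c : hi' c = hb by rewrite hiE // eqxx.
split.
  move=> p pn; have [p_in|p_out] := boolP (la <= p <= hb).
    rewrite (lab'_in _ p_in) lo'c hi'c; split=> //.
    have [pr|pr] := leqP p r.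
      have lp : lab p = a by apply: in_a; lia.
      have [_ _ _ _] := u p pn; rewrite lp ha.
      have [->|pnr] := eqVneq p r; first by rewrite orbT /=; lia.
      rewrite orbF => <-; lia.
    have lp : lab p = b by apply: in_b; lia.
    have [_ _ _ _] := u p pn; rewrite lp -/hb => ->.
    by rewrite (_ : (p == r) = false) ?orbF //; lia.
  have [lp pc] := lab'_out _ pn p_out; rewrite lp.
  have [lpn lop hin same hp] := u p pn.
  rewrite loE // hiE // (negPf pc); split=> //.
    move=> q hq; have qn : q <= n by lia.
    have lq := same q hq; have [q_in|q_out] := boolP (la <= q <= hb); last first.
      by have [-> _] := lab'_out _ qn q_out.
    exfalso; have [qr|qr] := leqP q r.
      have pa : lab p = a by rewrite -lq; apply: in_a; lia.
      have := a_in p pn pa; lia.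
    have pb : lab p = b by rewrite -lq; apply: in_b; lia.
    have := b_in p pn pb; lia.
  by rewrite hp (_ : (p == r) = false) ?orbF //; lia.
have from_to : from <= to by case: cases => -[_ -> -> _]; lia.
have to_n : to <= n.+1 by case: cases => -[_ _ -> _]; lia.
(* Writing [to - from] as a sum of indicators reduces the claim to single positions: relabelled ones
   gain at least 1, all others lose nothing. *)
rewrite -(sum_interval from_to to_n) -big_split /=; apply: leq_sum => -[p pn] _ /=.
rewrite ltnS in pn; have [p_in|p_out] := boolP (la <= p <= hb); last first.
  have [-> pc] := lab'_out _ pn p_out; have [lpn _ _ _ _] := u p pn.
  rewrite loE // hiE // (negPf pc).
  suff -> : (from <= p < to) = false by rewrite addn0.
  by case: cases => -[_ fE tE _]; lia.
rewrite (lab'_in _ p_in) lo'c hi'c.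
have [pr|pr] := leqP p r.
  have -> : lab p = a by apply: in_a; lia.
  rewrite ha -/la; case: cases => -[sm fE tE _].
    have -> : from <= p < to by lia.
    by rewrite addn1; apply: trunc_log2_double_le => //; move: sm; rewrite /small; lia.
  have -> : (from <= p < to) = false by lia.
  by rewrite addn0; apply: leq_trunc_log; lia.
have -> : lab p = b by apply: in_b; lia.
rewrite lbE -/hb; case: cases => -[sm fE tE _].
  have -> : (from <= p < to) = false by lia.
  by rewrite addn0; apply: leq_trunc_log; lia.
have -> : from <= p < to by lia.
by rewrite addn1; apply: trunc_log2_double_le => //; move: sm; rewrite /small; lia.
Qed.

End UnionFind.

(** * Runs of equal bits *)

Section Runs.
Variable n : nat.
Implicit Type b : nat -> bool.

Definition run_end b p j : Prop :=
  [/\ p < j <= n, forall q, p <= q < j -> b q = b p & j < n -> b j != b p].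

Definition runs_from b p : nat :=
  (p < n) + \sum_(q < n.-1) ((p <= q) && (b q != b q.+1)).

(** Jumping to [j] either leaves the row or passes the break between j - 1 and [j], so every jump
    uses up one unit of the count. *)
Lemma runs_from_next b p j : run_end b p j -> (runs_from b j).+1 <= runs_from b p.
Proof.
move=> [/andP[pj jn] same next]; rewrite /runs_from.
have -> : p < n by lia.
have [jn'|nj] := ltnP j n; last first.
  by rewrite big1 // => q _; case: q => q /= hq; case: leqP => //; lia.
rewrite -addnS leq_add2l.
have jn1 : j.-1 < n.-1 by lia.
rewrite (bigD1 (Ordinal jn1)) //= [leqRHS](bigD1 (Ordinal jn1)) //=.
rewrite prednK ?(leq_ltn_trans _ pj) // (same j.-1); last by lia.
rewrite (_ : (j <= j.-1) = false) 1?(_ : (p <= j.-1) = true) /=; [|lia..].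
rewrite eq_sym next // add0n -add1n; apply: leq_add => //; apply: leq_sum => q _.
by case: (leqP j q) => //= jq; rewrite (_ : p <= q) //; lia.
Qed.

End Runs.

(** * Invariant of breadth-first search, independent of the machine *)

Section BreadthFirst.
Variables (n : nat) (e : rel nat) (src : nat).
Hypothesis e_lt : forall x y, e x y -> y < n.

Definition walk (y k : nat) : Prop :=
  exists p, [/\ path e src p, last src p = y & size p = k].

(* State of the search: [vq] lists the discovered vertices, the first [h] of
   which have been processed, and [b] bounds the labels. *)
Record bfs (vq : seq nat) (D : nat -> nat) (h b : nat) : Prop := Bfs {
  bfs_uniq : uniq vq;
  bfs_lt : forall y, y \in vq -> y < n;
  bfs_src : src \in vq;
  bfs_src0 : D src = 0;
  bfs_walk : forall y, y \in vq -> walk y (D y);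
  bfs_done : forall i y, i < h -> e (nth 0 vq i) y ->
    y \in vq /\ D y <= (D (nth 0 vq i)).+1;
  bfs_sorted : forall i j, i <= j -> j < size vq ->
    D (nth 0 vq i) <= D (nth 0 vq j);
  bfs_max : forall y, y \in vq -> D y <= b;
  bfs_small : forall j, j < size vq -> D (nth 0 vq j) <= j;
  bfs_inf : forall y, y < n -> y \notin vq -> D y = n;
  bfs_head : h <= size vq
}.

Lemma bfs_init D : src < n -> D src = 0 ->
  (forall y, y < n -> y != src -> D y = n) -> bfs [:: src] D 0 0.
Proof.
move=> sn D0 Dn; split=> //=.
- by move=> y; rewrite inE => /eqP->.
- by rewrite inE.
- by move=> y; rewrite inE => /eqP->; exists [::]; rewrite D0.
- by move=> i [|[]] //=; case: i => //=; rewrite D0.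
- by move=> y; rewrite inE => /eqP->; rewrite D0.
- by case=> //= _; rewrite D0.
- by move=> y yn; rewrite inE; apply: Dn.
Qed.

(** The queue stays sorted because the new label is [b] itself, the bound on all earlier labels.
    Minimality of labels is no part of the invariant; it follows at the end from [bfs_done]. *)
Lemma bfs_visit vq D h b y D' : bfs vq D h b -> h < size vq ->
  b = (D (nth 0 vq h)).+1 -> y \notin vq -> e (nth 0 vq h) y ->
  (forall z, z < n -> D' z = if z == y then b else D z) ->
  bfs (rcons vq y) D' h b.
Proof.
move=> I hs bE yv exy DE.
have yn : y < n by apply: e_lt exy.
have D'v z : z \in vq -> D' z = D z.
  move=> zv; rewrite DE ?(bfs_lt I) //; case: eqP => // zy.
  by rewrite zy (negPf yv) in zv.
have D'y : D' y = b by rewrite DE // eqxx.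
have nthv i : i < size vq -> nth 0 (rcons vq y) i = nth 0 vq i.
  by move=> iv; rewrite nth_rcons iv.
have D'n i : i < size vq -> D' (nth 0 (rcons vq y) i) = D (nth 0 vq i).
  by move=> iv; rewrite nthv // D'v // mem_nth.
have nthy : nth 0 (rcons vq y) (size vq) = y by rewrite nth_rcons ltnn eqxx.
split.
- by rewrite rcons_uniq yv (bfs_uniq I).
- by move=> z; rewrite mem_rcons inE => /orP[/eqP->|/(bfs_lt I)].
- by rewrite mem_rcons inE (bfs_src I) orbT.
- by rewrite D'v ?(bfs_src0 I) ?(bfs_src I).
- move=> z; rewrite mem_rcons inE => /orP[/eqP->|zv]; last first.
    by rewrite D'v //; apply: bfs_walk I _ zv.
  have [p [pp lp sp]] := bfs_walk I (mem_nth 0 hs).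
  by exists (rcons p y); rewrite rcons_path last_rcons size_rcons pp lp exy D'y sp bE.
- move=> i z ih; have is_ : i < size vq by apply: ltn_trans ih hs.
  rewrite D'n // nthv // => ez; have [zv le] := bfs_done I ih ez.
  by rewrite mem_rcons inE zv orbT D'v.
- move=> i j ij; rewrite size_rcons ltnS leq_eqVlt => /orP[/eqP je|js].
    rewrite je nthy D'y; move: ij; rewrite je leq_eqVlt => /orP[/eqP->|is_].
      by rewrite nthy D'y.
    by rewrite D'n //; apply: bfs_max I _ (mem_nth _ is_).
  by rewrite !D'n ?(leq_ltn_trans ij) //; apply: bfs_sorted I _ _ ij js.
- move=> z; rewrite mem_rcons inE => /orP[/eqP->|zv]; first by rewrite D'y.
  by rewrite D'v //; apply: bfs_max I _ zv.
- move=> j; rewrite size_rcons ltnS leq_eqVlt => /orP[/eqP->|js].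
    by rewrite nthy D'y bE; apply: leq_ltn_trans (bfs_small I hs) hs.
  by rewrite D'n //; apply: bfs_small I _ js.
- move=> z zn; rewrite mem_rcons inE negb_or => /andP[zy zv].
  by rewrite DE // (negPf zy); apply: bfs_inf I _ zn zv.
by rewrite size_rcons ltnW // ltnS (bfs_head I).
Qed.

Lemma bfs_next vq D h b : bfs vq D h b -> h < size vq ->
  b = (D (nth 0 vq h)).+1 -> (forall y, e (nth 0 vq h) y -> y \in vq) ->
  bfs vq D h.+1 b.
Proof.
move=> [? ? ? ? ? dn ? mx ? ? ?] hs bE nb; split=> // i y.
rewrite ltnS leq_eqVlt => /orP[/eqP->|ih] ey; last exact: dn.
have yv := nb _ ey.
by split=> //; rewrite -bE; apply: mx.
Qed.

Lemma bfs_weaken vq D h b b' : bfs vq D h b -> b <= b' -> bfs vq D h b'.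
Proof.
move=> [? ? ? ? ? dn ? mx ? ? ?] bb; split=> // y yv.
exact: leq_trans (mx y yv) bb.
Qed.

Lemma bfs_complete vq D b p : bfs vq D (size vq) b -> path e src p ->
  last src p \in vq /\ D (last src p) <= size p.
Proof.
move=> I; elim/last_ind: p => [_|p y IH].
  by rewrite /= (bfs_src I) (bfs_src0 I).
rewrite rcons_path last_rcons size_rcons => /andP[/IH [lv lD] ey].
have iv : index (last src p) vq < size vq by rewrite index_mem.
have := bfs_done I iv; rewrite nth_index // => /(_ y ey) [yv yD].
by split=> //; apply: leq_trans yD _; rewrite ltnS.
Qed.

End BreadthFirst.

(** * The program: sorting *)

Definition add (e1 e2 : expr) : expr := Bin OAdd e1 e2.
Definition mul (e1 e2 : expr) : expr := Bin OMul e1 e2.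
Definition sub (e1 e2 : expr) : expr := Bin OSub e1 e2.
Definition lt (e1 e2 : expr) : expr := Bin OLt e1 e2.
Definition eqe (e1 e2 : expr) : expr := Bin OEq e1 e2.

(* The memory is cut into arrays of n^2 cells: 0 input, 1 output, 2 run ends,
   3 current order, 4 scratch, 5 block labels, 6 and 7 left and right ends of
   the blocks, 8 queue. Registers 0 and 1 hold n and n^2. *)
Definition addr (i : nat) (e : expr) : expr := add (mul (Cst i) (Reg 1)) e.
Definition rd (i : nat) (e : expr) : expr := Fetch (addr i e).
Definition st (i : nat) (e1 e2 : expr) : cmd := Store (addr i e1) e2.

(** Register 2 receives [up_log 2 n], found by doubling register 3 until it reaches [n]; register 4
    receives the number of columns to draw, and array 3 the identity order. *)
Definition setup_cmd (a : nat) : cmd :=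
  Seq (Assign 1 (mul (Reg 0) (Reg 0)))
 (Seq (Assign 2 (Cst 0))
 (Seq (Assign 3 (Cst 1))
 (Seq (While (lt (Reg 3) (Reg 0))
        (Seq (Assign 3 (add (Reg 3) (Reg 3))) (Assign 2 (add (Reg 2) (Cst 1)))))
 (Seq (Assign 4 (mul (Cst a) (mul (Reg 0) (Reg 2))))
 (Seq (Assign 7 (Cst 0))
      (for_loop 7 (Reg 0) (st 3 (Reg 7) (Reg 7)))))))).

Definition filter_cmd (b : nat) : cmd :=
  Seq (Assign 7 (Cst 0))
    (for_loop 7 (Reg 0)
      (If (eqe (rd 0 (add (mul (rd 3 (Reg 7)) (Reg 0)) (Reg 6))) (Cst b))
        (Seq (st 4 (Reg 8) (rd 3 (Reg 7))) (Assign 8 (add (Reg 8) (Cst 1))))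
        Skip)).

Definition pass_cmd : cmd :=
  Seq (Assign 8 (Cst 0)) (Seq (filter_cmd 0) (Seq (filter_cmd 1)
  (Seq (Assign 7 (Cst 0)) (for_loop 7 (Reg 0) (st 3 (Reg 7) (rd 4 (Reg 7))))))).

Definition sort_cmd : cmd :=
  Seq (Assign 5 (Cst 0))
    (for_loop 5 (Reg 4)
      (Seq (Rand 6) (Seq (Assign 6 (Bin OMod (Reg 6) (Reg 0))) pass_cmd))).

Arguments upd f a x b /.

Lemma bool_lt (b : bool) B : 1 < B -> b < B.
Proof. by apply: leq_trans; case: b. Qed.

Ltac fit := repeat split; solve [exact: bool_lt | lia].

Section Program.
Variables (n : nat) (G : sgraph n) (w : nat).
Hypothesis n1 : 1 < n.
Hypothesis big : 16 * (n * n) < 2 ^ w.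

Local Notation NN := (n * n).

Definition eqregs (l : seq nat) (rg rg' : nat -> nat) : Prop :=
  forall r, r \notin l -> rg' r = rg r.

Definition eqmem (l : seq nat) (m m' : nat -> nat) : Prop :=
  forall i j, i \notin l -> j < NN -> m' (i * NN + j) = m (i * NN + j).

Definition holds (m : nat -> nat) (i : nat) (s : seq nat) : Prop :=
  forall j, j < size s -> m (i * NN + j) = nth 0 s j.

Definition base (rg m : nat -> nat) : Prop :=
  [/\ rg 0 = n, rg 1 = NN
    & forall x y, x < n -> y < n -> m (0 * NN + (x * n + y)) = adjn G x y].

(** An array of n^2 cells thus has room for the positions 0 to [n], including the sentinel of the
    union-find. *)
Lemma n_lt_NN j : j <= n -> j < NN.
Proof. by clear big; nia. Qed.

Lemma index_lt x y : x < n -> y < n -> x * n + y < NN.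
Proof. by clear big n1; nia. Qed.

Lemma eqregs_trans l l' rg rg' rg'' : eqregs l rg rg' -> eqregs l' rg' rg'' ->
  eqregs (l ++ l') rg rg''.
Proof. by move=> h h' r; rewrite mem_cat negb_or => /andP[/h <- /h']. Qed.

Lemma eqmem_trans l l' m m' m'' : eqmem l m m' -> eqmem l' m' m'' ->
  eqmem (l ++ l') m m''.
Proof.
move=> h h' i j; rewrite mem_cat negb_or => /andP[/h {}h /h' {}h'] jn.
by rewrite h' // h.
Qed.

Lemma eqregs_sub l l' rg rg' : {subset l <= l'} -> eqregs l rg rg' -> eqregs l' rg rg'.
Proof. by move=> s h r rl; apply: h; apply: contra rl; apply: s. Qed.

Lemma eqmem_sub l l' m m' : {subset l <= l'} -> eqmem l m m' -> eqmem l' m m'.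
Proof. by move=> s h i j il; apply: h; apply: contra il; apply: s. Qed.

Lemma base_frame lr lm rg m rg' m' : base rg m -> eqregs lr rg rg' -> eqmem lm m m' ->
  0 \notin lr -> 1 \notin lr -> 0 \notin lm -> base rg' m'.
Proof.
move=> [r0 r1 m0] hr hm l0 l1 lm0; split; rewrite ?hr // => x y xn yn.
by rewrite hm ?m0 //; apply: index_lt.
Qed.

Lemma holds_frame lm m m' i s : holds m i s -> eqmem lm m m' -> i \notin lm ->
  size s <= n -> holds m' i s.
Proof. by move=> h hm il sn j js; rewrite hm ?h //; apply: n_lt_NN; exact: leq_trans (ltnW js) sn. Qed.

Lemma region_inj i j i' j' : j < NN -> j' < NN ->
  (i * NN + j == i' * NN + j') = (i == i') && (j == j').
Proof.
move=> jn jn'; apply/eqP/andP => [e|[/eqP-> /eqP->]//].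
have N0 : 0 < NN by clear big; lia.
have /= := congr1 (modn^~ NN) e; rewrite !modnMDl !modn_small // => ->.
have /= := congr1 (divn^~ NN) e; rewrite !divnMDl // !divn_small // !addn0 => ->.
by [].
Qed.

Definition written (m : nat -> nat) (i j v : nat) (m' : nat -> nat) : Prop :=
  forall i' j', j' < NN ->
    m' (i' * NN + j') = if (i' == i) && (j' == j) then v else m (i' * NN + j').

(** With nine arrays all addresses are below 9 n^2, which fits in a word by [big]. The 5 extra units
    are 4 for the address computation and 1 for the store. *)
Lemma run_st i e1 e2 rg m tp j v (Q : state -> nat -> Prop) :
  rg 1 = NN -> i < 9 -> fits (2 ^ w) (State rg m tp) e1 ->
  fits (2 ^ w) (State rg m tp) e2 -> evn (State rg m tp) e1 = j -> j < NN ->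
  evn (State rg m tp) e2 = v ->
  (forall m', written m i j v m' -> Q (State rg m' tp) (ecost e1 + ecost e2 + 5)) ->
  run w (st i e1 e2) (State rg m tp) Q.
Proof.
move=> r1 i9 f1 f2 e1E jn e2E q; apply: run_store => //.
  rewrite /= r1 e1E; split=> //; first split=> //; nia.
rewrite /= e1E e2E r1; set t := (X in Q _ X).
have -> : t = ecost e1 + ecost e2 + 5 by rewrite /t; lia.
by apply: q => i' j' jn'; rewrite /= region_inj.
Qed.

Lemma eqmem_refl l m : eqmem l m m.
Proof. by []. Qed.

Lemma eqregs_upd l rg rg' r v : eqregs l rg rg' -> r \in l -> eqregs l rg (upd rg' r v).
Proof.
move=> h rl r' rl'; rewrite /=; case: eqP => [e|_]; last exact: h.
by rewrite e rl in rl'.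
Qed.

Lemma eqmem_write l m m' m'' i j v : eqmem l m m' -> written m' i j v m'' -> i \in l ->
  eqmem l m m''.
Proof.
move=> h wr il i' j' il' jn; rewrite wr //; case: eqP => [e|_] /=; last exact: h.
by rewrite e il in il'.
Qed.

Lemma holds_rcons m i s v m' : holds m i s -> written m i (size s) v m' -> size s < NN ->
  holds m' i (rcons s v).
Proof.
move=> h wr sn j; rewrite size_rcons ltnS => js; rewrite wr ?eqxx /=; last exact: leq_ltn_trans js sn.
rewrite nth_rcons; case: (ltngtP j (size s)) js => // js _; exact: h.
Qed.

Lemma word_gt1 : 1 < 2 ^ w. Proof. by move: big n1; nia. Qed.
Lemma word_gt j : j <= NN -> j < 2 ^ w. Proof. by move: big; lia. Qed.
Lemma word_gtn j : j <= n -> j < 2 ^ w.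
Proof. by move=> /n_lt_NN/ltnW/word_gt. Qed.

(** [pre] is what array 4 holds already, so that the rows with bit 1 can be appended behind those
    with bit 0. *)
Lemma run_filter (b : bool) rg m tp s c pre :
  base rg m -> rg 6 = c -> c < n -> holds m 3 s -> size s = n ->
  (forall x, x \in s -> x < n) -> holds m 4 pre -> rg 8 = size pre ->
  size pre + count (fun x => adjn G x c == b) s <= n ->
  run w (filter_cmd b) (State rg m tp) (fun s' t => exists rg' m',
    [/\ s' = State rg' m' tp, eqregs [:: 7; 8] rg rg', eqmem [:: 4] m m',
        t <= 60 * n + 20 &
        rg' 8 = size (pre ++ [seq x <- s | adjn G x c == b]) /\
        holds m' 4 (pre ++ [seq x <- s | adjn G x c == b])]).
Proof.
move=> bs r6 cn hs sz sn hp r8 cnt.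
pose f i := pre ++ [seq x <- take i s | adjn G x c == b].
pose I i st := exists rg' m', [/\ st = State rg' m' tp, rg' 7 = i /\ rg' 8 = size (f i),
  eqregs [:: 7; 8] rg rg', eqmem [:: 4] m m' & holds m' 4 (f i)].
have B1 := word_gt1; have nB := word_gtn (leqnn n); have nNN := n_lt_NN (leqnn n).
apply: run_seq; apply: run_assign => //=; first by lia.
apply: (@run_for w I n 60 _ _ _ 0) => //.
- move=> i _ [rg' [m' [-> [r7 _] er em _]]] /=.
  by have [-> _ _] := base_frame bs er em isT isT isT.
- move=> i _ ni [rg' [m' [-> [r7 r8'] er em h4]]].
  have [r0 r1 m0] := base_frame bs er em isT isT isT.
  have hs' : holds m' 3 s by apply: holds_frame hs em _ _; rewrite ?sz.
  have m3 : m' (3 * NN + i) = nth 0 s i by rewrite hs' ?sz.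
  have r6' : rg' 6 = c by rewrite er.
  set x := nth 0 s i in m3; have xn : x < n by apply: sn; rewrite mem_nth ?sz.
  have m0x := m0 _ _ xn cn; have iN := n_lt_NN (ltnW ni).
  have xc := index_lt xn cn.
  have fS : f i.+1 = if adjn G x c == b then rcons (f i) x else f i.
    rewrite /f (take_nth 0) ?sz // filter_rcons -/x; case: ifP => // _.
    by rewrite -rcons_cat.
  have szf : size (f i) <= n.
    rewrite size_cat size_filter (leq_trans _ cnt) // leq_add2l.
    by rewrite -[in X in _ <= X](cat_take_drop i s) count_cat leq_addr.
  apply: run_if.
    by rewrite /= r0 r1 r7 m3 r6' m0x; fit.
  rewrite /= r0 r1 r7 m3 r6' m0x.
  have -> : (((adjn G x c : nat) == b : nat) != 0) = (adjn G x c == b).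
    by case: (b); case: (adjn _ _ _).
  case: ifP => ab; rewrite ab in fS; last first.
    apply: run_skip; rewrite /=; split=> //; exists (upd rg' 7 i.+1), m'.
    by rewrite /= fS; split=> //; apply: eqregs_upd.
  apply: run_seq; apply: run_st => //=.
    by rewrite r1 r7; fit.
    by rewrite r8'; apply: n_lt_NN.
  move=> m'' wr; rewrite r1 r7 m3 r8' in wr.
  apply: run_assign; first by rewrite /= r8'; fit.
  rewrite /=; split=> //; exists (upd (upd rg' 8 (rg' 8 + 1)) 7 i.+1), m''.
  rewrite fS size_rcons /= r8' addn1; split=> //.
  + by apply: eqregs_upd => //; apply: eqregs_upd.
  + exact: eqmem_write em wr _.
  by apply: holds_rcons h4 wr _; apply: n_lt_NN.
- exists (upd rg 7 0), m; rewrite /f take0 /= cats0; split=> //.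
  exact: eqregs_upd.
move=> s' t [rg' [m' [-> [_ r8'] er em h4]]] le.
rewrite /f take_oversize ?sz // in r8' h4; exists rg', m'; split=> //.
by move: le => /=; lia.
Qed.

Lemma run_pass rg m tp s c :
  base rg m -> rg 6 = c -> c < n -> holds m 3 s -> perm_eq s (iota 0 n) ->
  run w pass_cmd (State rg m tp) (fun s' t => exists rg' m',
    [/\ s' = State rg' m' tp, eqregs [:: 7; 8] rg rg', eqmem [:: 3; 4] m m',
        t <= 180 * n + 100 & holds m' 3 (pass G s c)]).
Proof.
move=> bs r6 cn hs ps.
have B1 := word_gt1; have nB := word_gtn (leqnn n); have nNN := n_lt_NN (leqnn n).
have sz : size s = n by rewrite (perm_size ps) size_iota.
have sn x : x \in s -> x < n by rewrite (perm_mem ps) mem_iota.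
have pE : pass G s c = [seq x <- s | adjn G x c == false] ++ [seq x <- s | adjn G x c == true].
  by rewrite /pass; congr cat; apply: eq_filter => x; case: adjn.
have szp : size (pass G s c) = n by rewrite (perm_size (perm_pass _ _ _)).
apply: run_seq; apply: run_assign; first by rewrite /=; lia.
have er0 : eqregs [:: 7; 8] rg (upd rg 8 0) by exact: eqregs_upd.
have bs0 := base_frame bs er0 (@eqmem_refl [::] m) isT isT isT.
have sz0 : size [seq x <- s | adjn G x c == false] + size [seq x <- s | adjn G x c == true] = n.
  by rewrite -size_cat -pE.
apply: run_seq; apply: run_weaken; first apply: (@run_filter false _ m tp s c [::] bs0) => //.
  by rewrite -size_filter /=; lia.
move=> _ t1 [rg1 [m1 [-> er1 em1 le1 [r8 h4]]]].
have bs1 := base_frame bs0 er1 em1 isT isT isT.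
have h31 : holds m1 3 s by apply: holds_frame hs em1 _ _; rewrite ?sz.
have r61 : rg1 6 = c by rewrite er1.
apply: run_seq; apply: run_weaken; first apply: (@run_filter true rg1 m1 tp s c _ bs1 _ _ _ _ _ h4) => //.
  by rewrite -size_filter /=; lia.
move=> _ t2 [rg2 [m2 [-> er2 em2 le2 [_ h42]]]].
rewrite /= -pE in h42.
have bs2 := base_frame bs1 er2 em2 isT isT isT.
apply: run_seq; apply: run_assign; first by rewrite /=; lia.
have er : eqregs [:: 7; 8] rg rg2.
  by apply: eqregs_sub (eqregs_trans er0 (eqregs_trans er1 er2)) => r; rewrite !inE; lia.
have em : eqmem [:: 3; 4] m m2.
  by apply: eqmem_sub (eqmem_trans em1 em2) => r; rewrite !inE; lia.
pose I i st := exists rg' m', [/\ st = State rg' m' tp, rg' 7 = i,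
  eqregs [:: 7; 8] rg rg', eqmem [:: 3] m2 m' &
  forall j, j < i -> m' (3 * NN + j) = nth 0 (pass G s c) j].
apply: (@run_for w I n 40 _ _ _ 0) => //.
- move=> i _ [rg' [m' [-> r7 er' em' _]]] /=.
  by have [-> _ _] := base_frame bs er' (@eqmem_refl [::] m) isT isT isT.
- move=> i _ ni [rg' [m' [-> r7 er' em' h]]].
  have [r0 r1 _] := base_frame bs er' (@eqmem_refl [::] m) isT isT isT.
  have iN := n_lt_NN (ltnW ni).
  have m4 : m' (4 * NN + i) = nth 0 (pass G s c) i by rewrite em' // h42 // szp.
  apply: run_st => //=; rewrite ?r1 ?r7 //; first by fit.
  move=> m'' wr; rewrite m4 in wr; split=> //.
  exists (upd rg' 7 i.+1), m''; split=> //; first exact: eqregs_upd.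
    exact: eqmem_write em' wr _.
  move=> j; rewrite ltnS => ji; rewrite wr /=; last by lia.
  by case: eqP => [->//|ne]; apply: h; lia.
- by exists (upd rg2 7 0), m2; split=> //; apply: eqregs_upd.
move=> s' t [rg' [m' [-> _ er' em' h]]] le; exists rg', m'; split=> //.
- by apply: eqmem_sub (eqmem_trans em em') => r; rewrite !inE; lia.
- by move: le le1 le2 => /=; lia.
by move=> j; rewrite szp; apply: h.
Qed.

Lemma run_sort rg m tp N :
  base rg m -> rg 4 = N -> N < 2 ^ w -> holds m 3 (iota 0 n) ->
  run w sort_cmd (State rg m tp) (fun s' t => exists rg' m' tp',
    [/\ s' = State rg' m' tp', eqregs [:: 5; 6; 7; 8] rg rg', eqmem [:: 3; 4] m m',
        t <= N * (180 * n + 120) + 10 &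
        holds m' 3 (radix G (sampled_columns n N tp))]).
Proof.
move=> bs r4 NB hs; have B1 := word_gt1.
have nB := word_gtn (leqnn n).
pose I i st := exists rg' m' tp', [/\ st = State rg' m' tp',
  rg' 5 = i /\ (forall j, tp' j = tp (i + j)),
  eqregs [:: 5; 6; 7; 8] rg rg', eqmem [:: 3; 4] m m' &
  holds m' 3 (radix G (sampled_columns n i tp))].
apply: run_seq; apply: run_assign; first by rewrite /=; lia.
apply: (@run_for w I N (180 * n + 120) _ _ _ 0) => //.
- by move=> i _ [rg' [m' [tp' [-> [r5 _] er em _]]]] /=; rewrite (er 4).
- move=> i _ Ni [rg' [m' [tp' [-> [r5 tpE] er em h]]]].
  have bs' := base_frame bs er em isT isT isT; have [r0 r1 _] := bs'.
  set c := tp i %% n; have cn : c < n by rewrite ltn_mod; lia.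
  have tp0 : tp' 0 = tp i by rewrite tpE addn0.
  apply: run_seq; apply: run_rand; apply: run_seq; apply: run_assign.
    by rewrite /= r0 tp0; split=> //; apply: ltn_trans cn nB.
  rewrite /= r0 tp0 -/c.
  set rg1 := upd (upd _ _ _) 6 c.
  have er1 : eqregs [:: 5; 6; 7; 8] rg rg1 by do 2! apply: eqregs_upd => //.
  have bs1 : base rg1 m' := base_frame bs er1 em isT isT isT.
  apply: run_weaken; first exact: (run_pass _ bs1 _ cn h (perm_radix _ _)).
  move=> s' t [rg2 [m2 [-> er2 em2 le h2]]].
  split; [by rewrite /=; lia|by rewrite /= er2|].
  exists (upd rg2 5 i.+1), m2, (fun j => tp' j.+1); split=> //=.
  + by split=> // j; rewrite tpE addnS.
  + apply: eqregs_upd => //.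
    by apply: eqregs_sub (eqregs_trans er1 er2) => r; rewrite !inE; lia.
  + by apply: eqmem_sub (eqmem_trans em em2) => r; rewrite !inE; lia.
  by rewrite /sampled_columns mkseqS /radix foldl_rcons.
- by exists (upd rg 5 0), m, tp; split=> //; apply: eqregs_upd.
move=> s' t [rg' [m' [tp' [-> [_ _] er em h]]]] le; exists rg', m', tp'; split=> //.
by move: le => /=; lia.
Qed.

Lemma run_setup a tp : a * (n * up_log 2 n) < 2 ^ w ->
  run w (setup_cmd a) (init_state G tp) (fun s' t => exists rg' m',
    [/\ s' = State rg' m' tp, base rg' m', rg' 4 = a * (n * up_log 2 n),
        t <= 100 * n + 100 & holds m' 3 (iota 0 n)]).
Proof.
move=> aB; have B1 := word_gt1; have n2 : 2 * n <= NN by nia.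
set L := up_log 2 n; have nB := word_gtn (leqnn n).
have nL : n <= 2 ^ L by apply: up_logP.
have Ln : L <= n by apply: up_log_min => //; apply: ltnW; apply: ltn_expl.
rewrite /init_state; set m := input_mem G.
apply: run_seq; apply: run_assign; first by rewrite /=; fit.
rewrite /=; apply: run_seq; apply: run_assign; first by rewrite /=; lia.
rewrite /=; apply: run_seq; apply: run_assign; first by rewrite /=; lia.
rewrite /=; set rg := upd _ 3 1.
pose I (k : nat) st := exists rg', [/\ st = State rg' m tp, rg' 3 = 2 ^ k, rg' 2 = k,
  k <= L & eqregs [:: 2; 3] rg rg'].
pose pot (k : nat) (_ : state) := (L - k) * 20.
have L0 : 0 < L by rewrite up_log_gt0.
have aL : a <= a * (n * L) by rewrite leq_pmulr // muln_gt0 L0 andbT; lia.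
have nLn : n * L <= NN by rewrite leq_mul2l Ln orbT.
apply: run_seq; apply: run_weaken; first apply: (@run_while w nat I pot _ _ 0).
- move=> k _ [rg' [-> r3 r2 kL er]] /=; fit.
- move=> k _ [rg' [-> r3 r2 kL er]]; have r0 : rg' 0 = n by rewrite er.
  rewrite /= r3 r0 => lt.
  have {}lt : 2 ^ k < n by case: ltnP lt.
  have kL' : k < L by rewrite -(ltn_exp2l (m := 2)) //; apply: leq_trans nL.
  apply: run_seq; apply: run_assign; first by rewrite /= r3; fit.
  apply: run_assign; first by rewrite /= r2; fit.
  exists k.+1; last by rewrite /pot /=; lia.
  rewrite /= r3 r2; eexists; split; [by []| | |by []|] => /=.
  + by rewrite expnS; lia.
  + by rewrite addn1.
  by do 2! apply: eqregs_upd => //.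
- by exists rg; split.
move=> _ t [k [rg' [-> r3 r2 kL er]] []]; have r0 : rg' 0 = n by rewrite er.
rewrite /= r3 r0 => /eqP; rewrite eqb0 -leqNgt => nk le.
have {nk kL}kL : k = L by apply/eqP; rewrite eqn_leq kL; apply: up_log_min.
rewrite {}kL in r2 r3 le.
have r1 : rg' 1 = NN by rewrite er.
apply: run_seq; apply: run_assign.
  by rewrite /= r0 r2; repeat split=> //; [apply: leq_ltn_trans aB|apply: word_gt].
rewrite /= r0 r2; apply: run_seq; apply: run_assign; first by rewrite /=; lia.
rewrite /=; set rg1 := upd (upd _ _ _) 7 0.
pose I' i st := exists rg' m', [/\ st = State rg' m' tp, rg' 7 = i, eqregs [:: 7] rg1 rg',
  eqmem [:: 3] m m' & forall j, j < i -> m' (3 * NN + j) = j].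
apply: (@run_for w I' n 40 _ _ _ 0) => //.
- by move=> i _ [rg2 [m2 [-> r7 er2 em2 _]]] /=; rewrite (er2 0).
- move=> i _ ni [rg2 [m2 [-> r7 er2 em2 h]]].
  have iN := n_lt_NN (ltnW ni).
  apply: run_st => //=; rewrite ?r7 ?er2 //.
  move=> m3 wr; split=> //; exists (upd rg2 7 i.+1), m3; split=> //.
  + exact: eqregs_upd.
  + exact: eqmem_write em2 wr _.
  move=> j; rewrite ltnS => ji; rewrite wr /=; last by lia.
  by case: eqP => [->//|ne]; apply: h; lia.
- by exists rg1, m; split.
move=> _ t' [rg2 [m2 [-> r7 er2 em2 h]]] le2; exists rg2, m2; split=> //.
- split; rewrite ?er2 //= => x y xn yn.
  by rewrite em2 ?index_lt // mul0n add0n /m input_memE.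
- by rewrite er2.
- by move: le le2; rewrite /pot /=; lia.
by move=> j; rewrite size_iota => jn; rewrite h // nth_iota.
Qed.

End Program.

(** * The program: run ends and visits *)

(** Each row is treated from right to left: the run of a position ends just after it, or where the
    run of the next position ends if the two bits agree. *)
Definition ends_cmd : cmd :=
  Seq (Assign 5 (Cst 0))
  (for_loop 5 (Reg 0)
    (Seq (Assign 7 (Reg 0))
    (While (lt (Cst 0) (Reg 7))
      (Seq (Assign 7 (sub (Reg 7) (Cst 1)))
      (Seq (Assign 8 (add (Reg 7) (Cst 1)))
      (Seq (If (lt (Reg 8) (Reg 0))
             (If (eqe (rd 0 (add (mul (Reg 5) (Reg 0)) (rd 3 (Reg 7))))
                      (rd 0 (add (mul (Reg 5) (Reg 0)) (rd 3 (Reg 8)))))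
               (Assign 8 (rd 2 (add (mul (Reg 5) (Reg 0)) (Reg 8)))) Skip)
             Skip)
           (st 2 (add (mul (Reg 5) (Reg 0)) (Reg 7)) (Reg 8)))))))).

(** Register 16 is the visited position, 9 the offset of the output row, 13 the label and 11 the
    queue length. Registers 17 and 18 hold the two blocks to be joined, 19 and 20 the ends of the
    union, 21 and 22 the range to relabel, 23 the surviving block. *)
Definition visit_cmd : cmd :=
  Seq (st 1 (add (Reg 9) (rd 3 (Reg 16))) (Reg 13))
 (Seq (st 8 (Reg 11) (rd 3 (Reg 16)))
 (Seq (Assign 11 (add (Reg 11) (Cst 1)))
 (Seq (Assign 17 (rd 5 (Reg 16)))
 (Seq (Assign 18 (rd 5 (add (Reg 16) (Cst 1))))
 (Seq (Assign 19 (rd 6 (Reg 17)))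
 (Seq (Assign 20 (rd 7 (Reg 18)))
 (Seq (If (lt (sub (Reg 16) (Reg 19)) (sub (Reg 20) (Reg 16)))
        (Seq (Assign 21 (Reg 19))
        (Seq (Assign 22 (add (Reg 16) (Cst 1))) (Assign 23 (Reg 18))))
        (Seq (Assign 21 (add (Reg 16) (Cst 1)))
        (Seq (Assign 22 (add (Reg 20) (Cst 1))) (Assign 23 (Reg 17)))))
 (Seq (for_loop 21 (Reg 22) (st 5 (Reg 21) (Reg 23)))
 (Seq (st 6 (Reg 23) (Reg 19))
      (st 7 (Reg 23) (Reg 20))))))))))).

Section Search.
Variables (n : nat) (G : sgraph n) (w : nat).
Hypothesis n1 : 1 < n.
Hypothesis big : 16 * (n * n) < 2 ^ w.
Local Notation NN := (n * n).
Local Notation eqmem := (eqmem n).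
Local Notation holds := (holds n).
Local Notation written := (written n).
Local Notation base := (base G).

Lemma run_end_last b p : p < n -> (p.+1 < n -> b p.+1 != b p) -> run_end n b p p.+1.
Proof.
move=> pn h; split=> //; first by rewrite leqnn.
by move=> q hq; have -> : q = p by lia.
Qed.

Lemma run_end_extend b p j : b p = b p.+1 -> run_end n b p.+1 j -> run_end n b p j.
Proof.
move=> e [h1 h2 h3]; split; first by lia.
  move=> q hq; have [->//|qp] := eqVneq q p.
  by rewrite e; apply: h2; lia.
by rewrite e.
Qed.

Variable ord : seq nat.
Hypothesis pord : perm_eq ord (iota 0 n).

Lemma size_ord : size ord = n.
Proof. by rewrite (perm_size pord) size_iota. Qed.

Lemma ord_lt p : p < n -> nth 0 ord p < n.
Proof.
move=> pn; have := mem_nth 0 (_ : p < size ord); rewrite size_ord => /(_ pn).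
by rewrite (perm_mem pord) mem_iota.
Qed.

Definition row_bit (x q : nat) : bool := adjn G x (nth 0 ord q).

Definition ends (m : nat -> nat) (x p : nat) : Prop :=
  run_end n (row_bit x) p (m (2 * NN + (x * n + p))).

Lemma run_ends rg m tp :
  base rg m -> holds m 3 ord ->
  run w ends_cmd (State rg m tp) (fun s' t => exists rg' m',
    [/\ s' = State rg' m' tp, eqregs [:: 5; 7; 8] rg rg', eqmem [:: 2] m m',
        t <= n * (120 * n + 120) + 20 &
        forall x p, x < n -> p < n -> ends m' x p]).
Proof.
move=> bs hs; have B1 := word_gt1 n1 big; have nB := word_gtn n1 big (leqnn n).
have nNN := n_lt_NN n1 (leqnn n).
pose I x st := exists rg' m', [/\ st = State rg' m' tp, rg' 5 = x,
  eqregs [:: 5; 7; 8] rg rg', eqmem [:: 2] m m' &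
  forall x' p, x' < x -> p < n -> ends m' x' p].
apply: run_seq; apply: run_assign; first by rewrite /=; lia.
apply: (@run_for w I n (120 * n + 120) _ _ _ 0) => //.
- move=> x _ [rg' [m' [-> r5 er em _]]] /=.
  by have [-> _ _] := base_frame bs er em isT isT isT.
- move=> x _ xn [rg1 [m1 [-> r51 er1 em1 h1]]].
  have [r01 _ _] := base_frame bs er1 em1 isT isT isT.
  apply: run_seq; apply: run_assign => //=; rewrite r01.
  pose J p st := exists rg' m', [/\ st = State rg' m' tp, rg' 5 = x /\ rg' 7 = p,
    eqregs [:: 5; 7; 8] rg rg' /\ eqmem [:: 2] m m', p <= n &
    (forall x' p', x' < x -> p' < n -> ends m' x' p') /\
    (forall p', p <= p' < n -> ends m' x p')].
  pose pot (p : nat) (_ : state) := p * 120.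
  apply: run_weaken; first apply: (@run_while w nat J pot _ _ n).
  + by move=> p _ [rg' [m' [-> [r5 r7] [er em] pn _]]] /=; fit.
  + move=> p _ [rg2 [m2 [-> [r5 r7] [er em] pn [hx hp]]]].
    rewrite /= r7; case: p pn r7 hp => [//|p] pn r7 hp _.
    have bs2 := base_frame bs er em isT isT isT; have [r0 r1 m0] := bs2.
    have h3 : holds m2 3 ord by apply: (holds_frame n1 hs em); rewrite ?size_ord.
    apply: run_seq; apply: run_assign; first by rewrite /= r7; fit.
    apply: run_seq; apply: run_assign; first by rewrite /= r7; fit.
    rewrite /= r7 subn1 addn1 /=.
    set rg3 := upd (upd _ _ _) 8 p.+1.
    have r03 : rg3 0 = n := r0; have r13 : rg3 1 = NN := r1.
    have r53 : rg3 5 = x := r5; have r73 : rg3 7 = p by [].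
    have r83 : rg3 8 = p.+1 by [].
    have ipx := index_lt xn pn.
    have mid : run w (If (lt (Reg 8) (Reg 0))
             (If (eqe (rd 0 (add (mul (Reg 5) (Reg 0)) (rd 3 (Reg 7))))
                      (rd 0 (add (mul (Reg 5) (Reg 0)) (rd 3 (Reg 8)))))
               (Assign 8 (rd 2 (add (mul (Reg 5) (Reg 0)) (Reg 8)))) Skip)
             Skip) (State rg3 m2 tp) (fun s' t => exists rg4,
         [/\ s' = State rg4 m2 tp, eqregs [:: 8] rg3 rg4, run_end n (row_bit x) p (rg4 8)
           & t <= 60]).
      apply: run_if; first by rewrite /= r83; fit.
      rewrite /= r03 r83; case: (ltnP p.+1 n) => [pn'|np] /=; last first.
        by apply: run_skip; exists rg3; split=> //; rewrite r83; apply: run_end_last => //; lia.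
      have m3p : m2 (3 * NN + p) = nth 0 ord p by rewrite h3 ?size_ord.
      have m3p' : m2 (3 * NN + p.+1) = nth 0 ord p.+1 by rewrite h3 ?size_ord.
      have [op op'] := (ord_lt pn, ord_lt pn').
      have := index_lt xn op; have := index_lt xn op'; have ipx' := index_lt xn pn'.
      move=> i1 i2.
      apply: run_if.
        by rewrite /= r03 r13 r53 r73 r83 m3p m3p' !m0 //; fit.
      rewrite /= r03 r13 r53 r73 r83 m3p m3p' !m0 //.
      have -> : (((adjn G x (nth 0 ord p) : nat) == adjn G x (nth 0 ord p.+1) : nat) != 0)
          = (row_bit x p == row_bit x p.+1).
        by rewrite /row_bit; case: (adjn _ _ _); case: (adjn _ _ _).
      case: eqP => [e|/eqP e].
        apply: run_assign; first by rewrite /= r03 r13 r53 r83; fit.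
        rewrite /= r03 r13 r53 r83; eexists; split; [by []|exact: eqregs_upd| |by []].
        by rewrite /=; apply: run_end_extend e (hp _ _); lia.
      apply: run_skip; exists rg3; split=> //; rewrite r83; apply: run_end_last => // _.
      by rewrite eq_sym.
    apply: run_seq; apply: run_weaken mid _ => _ t [rg4 [-> er4 re le]].
    have r04 : rg4 0 = n by rewrite er4.
    have r14 : rg4 1 = NN by rewrite er4.
    have r54 : rg4 5 = x by rewrite er4.
    have r74 : rg4 7 = p by rewrite er4.
    apply: (run_st n1 big) => //=; rewrite ?r04 ?r54 ?r74 //; first by fit.
    move=> m5 wr; exists p; last by rewrite /pot; lia.
    exists rg4, m5; split=> //; [split|lia|].
    * apply: eqregs_sub (eqregs_trans (_ : eqregs [:: 5; 7; 8] rg rg3) er4).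
        by move=> r; rewrite !inE; lia.
      by do 2! apply: eqregs_upd => //.
    * exact: eqmem_write em wr _.
    split=> [x' p' xx pp|p' pp].
      have ix : x' * n + p' < NN by apply: index_lt => //; lia.
      rewrite /ends wr //=; have -> : (x' * n + p' == x * n + p) = false by nia.
      exact: hx.
    have ix : x * n + p' < NN by apply: index_lt => //; lia.
    rewrite /ends wr //= eqn_add2l; case: eqP => [->//|ne].
    by apply: hp; lia.
  + exists (upd rg1 7 n), m1; split=> //; first by split=> //; apply: eqregs_upd.
    by split=> // p'; lia.
  move=> _ t [p [rg' [m' [-> [r5 r7] [er em] pn [hx hp]]]] []].
  rewrite /= r7 => p0; have {p0}p0 : p = 0 by move: p0; case: (p).
  rewrite {}p0 in hp r7; rewrite /pot => le.
  split=> //; first by lia.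
  exists (upd rg' 5 x.+1), m'; split=> //; first exact: eqregs_upd.
  move=> x' p'; rewrite ltnS leq_eqVlt => /orP[/eqP->|xx] pn'; last exact: hx.
  exact: hp.
- by exists (upd rg 5 0), m; split=> //; apply: eqregs_upd.
move=> _ t [rg' [m' [-> r5 er em h]]] le; exists rg', m'; split=> //.
by move: le => /=; lia.
Qed.

Definition labs (m : nat -> nat) (p : nat) : nat := m (5 * NN + p).
Definition los (m : nat -> nat) (p : nat) : nat := m (6 * NN + p).
Definition his (m : nat -> nat) (p : nat) : nat := m (7 * NN + p).

(** [pq] is the queue in terms of positions in [ord], on which the union-find acts; array 8 stores
    the corresponding vertices. *)
Definition visited (rg m : nat -> nat) (pq : seq nat) : Prop :=
  [/\ rg 11 = size pq, holds m 8 [seq nth 0 ord p | p <- pq], uniq pq,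
      forall p, p \in pq -> p < n
    & uf n (labs m) (los m) (his m) (fun p => p \in pq)].

Definition fpot (m : nat -> nat) : nat := uf_pot n (labs m) (los m) (his m).

Lemma size_visited (pq : seq nat) (r : nat) : uniq pq -> (forall p, p \in pq -> p < n) -> r < n ->
  r \notin pq -> size pq < n.
Proof.
move=> uq lq rn rq; have : uniq (r :: pq) by rewrite /= rq.
move=> uq'; rewrite -[X in _ < X](size_iota 0); apply: (uniq_leq_size uq') => z.
by rewrite inE mem_iota => /orP[/eqP->|/lq].
Qed.

Definition visit_regs := [:: 11; 17; 18; 19; 20; 21; 22; 23].
Definition visit_mem := [:: 1; 5; 6; 7; 8].

(** The only part of a visit that is not constant is the relabelling, at 30 units per cell;
    [uf_merge] charges it to the rise of the potential. *)
Lemma run_visit rg m tp (src r d : nat) (pq : seq nat) :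
  base rg m -> holds m 3 ord -> visited rg m pq -> src < n -> rg 9 = src * n ->
  rg 16 = r -> r < n -> r \notin pq -> rg 13 = d ->
  run w visit_cmd (State rg m tp) (fun s' t => exists rg' m',
    [/\ s' = State rg' m' tp, eqregs visit_regs rg rg', eqmem visit_mem m m',
        t + 30 * fpot m <= 200 + 30 * fpot m' &
        visited rg' m' (rcons pq r) /\
        forall j, j < NN -> m' (1 * NN + j) =
          if j == src * n + nth 0 ord r then d else m (1 * NN + j)]).
Proof.
move=> bs hs [r11 h8 uq lq uf0] srcn r9 r16 rn rq r13.
have B1 := word_gt1 n1 big; have nB := word_gtn n1 big (leqnn n).
have nNN := n_lt_NN n1 (leqnn n); have [r0 r1 _] := bs.
have kn := size_visited uq lq rn rq.
set y := nth 0 ord r; have yn : y < n by apply: ord_lt.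
have m3 : m (3 * NN + r) = y by rewrite hs ?size_ord.
have iy := index_lt srcn yn.
have kNN := n_lt_NN n1 (ltnW kn); have rNN := n_lt_NN n1 (ltnW rn).
have rNN' := n_lt_NN n1 rn.
apply: run_seq; apply: (run_st n1 big) => //=; rewrite ?r9 ?r1 ?r16 ?m3 //; first by fit.
move=> m1 wr1; rewrite r13 in wr1.
have m13 : m1 (3 * NN + r) = y by rewrite wr1 ?m3.
apply: run_seq; apply: (run_st n1 big) => //=; rewrite ?r11 ?r1 ?r16 ?m13 //; first by fit.
move=> m2 wr2.
have em2 : eqmem visit_mem m m2.
  by apply: eqmem_write (eqmem_write (@eqmem_refl n visit_mem m) wr1 isT) wr2 isT.
have m2E i p : i \in [:: 5; 6; 7] -> p < NN -> m2 (i * NN + p) = m (i * NN + p).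
  move=> hi hp; rewrite wr2 // wr1 //.
  by move: hi; rewrite !inE => /or3P[] /eqP->.
apply: run_seq; apply: run_assign; first by rewrite /= r11; fit.
rewrite /= r11 addn1.
set a := labs m r; set b := labs m r.+1; set la := los m a; set hb := his m b.
have [aN /andP[lar ahi] _ _ _] := uf0 r (ltnW rn); rewrite -/a -/la in aN lar.
have [bN /andP[_ bhi] hbn _ _] := uf0 r.+1 rn; rewrite -/b -/hb in bN bhi hbn.
have lan : la < NN by lia.
have aNN := n_lt_NN n1 aN; have bNN := n_lt_NN n1 bN; have hNN := n_lt_NN n1 hbn.
apply: run_seq; apply: run_assign; first by rewrite /= r1 r16; fit.
rewrite /= r1 r16 m2E // -/(labs m r) -/a.
apply: run_seq; apply: run_assign; first by rewrite /= r1 r16; fit.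
rewrite /= r1 r16 addn1 m2E // -/(labs m r.+1) -/b.
apply: run_seq; apply: run_assign; first by rewrite /= r1; fit.
rewrite /= r1 m2E // -/(los m a) -/la.
apply: run_seq; apply: run_assign; first by rewrite /= r1; fit.
rewrite /= r1 m2E // -/(his m b) -/hb.
set rg3 := upd _ 20 hb.
have er3 : eqregs visit_regs rg rg3 by do 5! apply: eqregs_upd => //.
have merge lab' lo' hi' := @uf_merge n (labs m) (los m) (his m) _ r lab' lo' hi' uf0 rn rq.
rewrite /= -/a -/b -/la -/hb in merge.
set small := r - la < hb - r in merge.
set from := if small then la else r.+1 in merge; set to := if small then r.+1 else hb.+1 in merge.
set c := if small then b else a in merge.
have r316 : rg3 16 = r := r16.
have r319 : rg3 19 = la by []; have r320 : rg3 20 = hb by [].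
apply: run_seq.
have mid Q : (forall rg4 t, eqregs [:: 21; 22; 23] rg3 rg4 -> rg4 21 = from ->
     rg4 22 = to -> rg4 23 = c -> t <= 30 -> Q (State rg4 m2 tp) t) ->
   run w (If (lt (sub (Reg 16) (Reg 19)) (sub (Reg 20) (Reg 16)))
        (Seq (Assign 21 (Reg 19))
        (Seq (Assign 22 (add (Reg 16) (Cst 1))) (Assign 23 (Reg 18))))
        (Seq (Assign 21 (add (Reg 16) (Cst 1)))
        (Seq (Assign 22 (add (Reg 20) (Cst 1))) (Assign 23 (Reg 17)))))
     (State rg3 m2 tp) Q.
  move=> q; apply: run_if; first by rewrite /= r316 r319 r320; fit.
  rewrite /= r316 r319 r320; rewrite /from /to /c /small in q.
  case: ltnP q => hsm q /=.
    apply: run_seq; apply: run_assign => //; apply: run_seq; apply: run_assign.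
      by rewrite /= r316; fit.
    apply: run_assign => //; apply: q => //=; last by rewrite r316 addn1.
    by do 3! apply: eqregs_upd => //.
  apply: run_seq; apply: run_assign; first by rewrite /= r316; fit.
  apply: run_seq; apply: run_assign; first by rewrite /= r320; fit.
  apply: run_assign => //; apply: q => //=; rewrite ?r316 ?r320 ?addn1 //.
  by do 3! apply: eqregs_upd => //.
apply: mid => rg4 t4 er4 r421 r422 r423 le4.
have from_to : from <= to by rewrite /from /to; case: ifP => sm; lia.
have to_n : to <= n.+1 by rewrite /to; case: ifP => _; lia.
have cN : c <= n by rewrite /c; case: ifP.
have cNN := n_lt_NN n1 cN.
pose I i st := exists rg' m', [/\ st = State rg' m' tp, rg' 21 = i, eqregs [:: 21] rg4 rg',
  eqmem [:: 5] m2 m' & from <= i /\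
  forall p, p <= n -> labs m' p = if from <= p < i then c else labs m p].
clearbody from to c; clear small.
have r41 : rg4 1 = NN by rewrite er4.
apply: run_seq; apply: (@run_for w I to 30 _ _ _ from) => //.
- by lia.
- by move=> i _ [rg' [m' [-> r21 er' em' _]]] /=; rewrite (er' 22).
- move=> i _ ito [rg' [m' [-> r21 er' em' [fi h]]]].
  have iN : i < NN by apply: n_lt_NN => //; lia.
  apply: (run_st n1 big) => //=; rewrite ?r21 ?er' ?r423 //.
  move=> m'' wr; split=> //; exists (upd rg' 21 i.+1), m''; split=> //.
  + exact: eqregs_upd.
  + exact: eqmem_write em' wr _.
  split=> [|p pn]; [by lia|rewrite /labs wr ?n_lt_NN // eqxx /=].
  have [->|pi] := eqVneq p i; last by rewrite -/(labs m' p) h // ltnS (leq_eqVlt p) (negPf pi).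
  by have -> : from <= i < i.+1 by lia.
- exists rg4, m2; split=> //; split=> // p pn.
  by rewrite (_ : (from <= p < from) = false) ?/labs ?m2E ?n_lt_NN //; lia.
move=> _ t5 [rg5 [m5 [-> _ er5 em5 [_ h5]]]] le5.
have r51 : rg5 1 = NN by rewrite er5.
have r523 : rg5 23 = c by rewrite er5.
have r519 : rg5 19 = la by rewrite er5 // er4.
have r520 : rg5 20 = hb by rewrite er5 // er4.
apply: run_seq; apply: (run_st n1 big) => //=; rewrite ?r523 ?r519 //.
move=> m6 wr6.
apply: (run_st n1 big) => //=; rewrite ?r523 ?r520 //.
move=> m7 wr7; exists rg5, m7.
have em7 : eqmem [:: 5; 6; 7] m2 m7.
  apply: (eqmem_write _ wr7); last by [].
  apply: (eqmem_write _ wr6); last by [].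
  by apply: eqmem_sub em5 => i; rewrite !inE => ->.
have lab7 p : p <= n -> labs m7 p = if from <= p < to then c else labs m p.
  by move=> pn; rewrite /labs wr7 ?wr6 ?n_lt_NN //= -/(labs m5 p) h5.
have lo7 p : p <= n -> los m7 p = if p == c then la else los m p.
  move=> pn; rewrite /los wr7 ?wr6 ?n_lt_NN //=; case: ifP => // _.
  by rewrite em5 ?n_lt_NN // m2E ?n_lt_NN.
have hi7 p : p <= n -> his m7 p = if p == c then hb else his m p.
  move=> pn; rewrite /his wr7 ?n_lt_NN //=; case: ifP => // _.
  by rewrite wr6 ?n_lt_NN //= em5 ?n_lt_NN // m2E ?n_lt_NN.
have [uf7 pot7] := merge _ _ _ lab7 lo7 hi7.
split=> //.
- apply: eqregs_sub (eqregs_trans er3 (eqregs_trans er4 er5)) => i; rewrite !inE; lia.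
- apply: eqmem_sub (eqmem_trans em2 em7) => i; rewrite !inE; lia.
- by move: le5 le4 pot7; rewrite /fpot /=; lia.
split; last first.
  by move=> j jn; rewrite em7 // wr2 // wr1.
split.
- by rewrite size_rcons er5 // er4.
- rewrite map_rcons; apply: (holds_frame n1 (m := m2)) em7 _ _ => //.
    apply: (holds_rcons (m := m1)); rewrite ?size_map //.
    by move=> j; rewrite size_map => jk; rewrite wr1 /= ?h8 ?size_map //; apply: n_lt_NN; lia.
  by rewrite size_rcons size_map.
- by rewrite rcons_uniq rq.
- by move=> p; rewrite mem_rcons inE => /orP[/eqP->|/lq].
move=> p pn; have [? ? ? ? e] := uf7 p pn; split=> //.
by rewrite e mem_rcons inE orbC.
Qed.

End Search.

(** * The program: one search *)

(** The nested read of arrays 5 and 7 is a find. Jumping from one unvisited position to the next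
    keeps visited neighbours from being touched again. *)
Definition run_cmd : cmd :=
  Seq (Assign 16 (rd 7 (rd 5 (Reg 14))))
    (While (lt (Reg 16) (Reg 15))
      (Seq visit_cmd (Assign 16 (rd 7 (rd 5 (Reg 16)))))).

(** One adjacency test decides a whole run, and a run of non-neighbours is skipped in constant
    time. *)
Definition scan_cmd : cmd :=
  Seq (Assign 14 (Cst 0))
  (While (lt (Reg 14) (Reg 0))
    (Seq (Assign 15 (rd 2 (add (mul (Reg 12) (Reg 0)) (Reg 14))))
    (Seq (If (rd 0 (add (mul (Reg 12) (Reg 0)) (rd 3 (Reg 14)))) run_cmd Skip)
         (Assign 14 (Reg 15))))).

Definition search_cmd : cmd :=
  Seq (Assign 10 (Cst 0))
  (While (lt (Reg 10) (Reg 11))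
    (Seq (Assign 12 (rd 8 (Reg 10)))
    (Seq (Assign 10 (add (Reg 10) (Cst 1)))
    (Seq (Assign 13 (add (rd 1 (add (Reg 9) (Reg 12))) (Cst 1))) scan_cmd)))).

(** Register 5 is the position of the source in the order, not the vertex. The row is filled with
    [n], the code of infinity; the blocks become singletons, including the sentinel, which explains
    n + 1 rounds; the source is then visited with label 0. *)
Definition source_cmd : cmd :=
  Seq (Assign 9 (mul (rd 3 (Reg 5)) (Reg 0)))
 (Seq (Assign 7 (Cst 0))
 (Seq (for_loop 7 (Reg 0) (st 1 (add (Reg 9) (Reg 7)) (Reg 0)))
 (Seq (Assign 7 (Cst 0))
 (Seq (for_loop 7 (add (Reg 0) (Cst 1))
        (Seq (st 5 (Reg 7) (Reg 7)) (Seq (st 6 (Reg 7) (Reg 7)) (st 7 (Reg 7) (Reg 7)))))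
 (Seq (Assign 11 (Cst 0))
 (Seq (Assign 13 (Cst 0))
 (Seq (Assign 16 (Reg 5))
 (Seq visit_cmd search_cmd)))))))).

Section Source.
Variables (n : nat) (G : sgraph n) (w : nat).
Hypothesis n1 : 1 < n.
Hypothesis big : 16 * (n * n) < 2 ^ w.
Local Notation NN := (n * n).
Local Notation eqmem := (eqmem n).
Local Notation holds := (holds n).
Local Notation base := (base G).

Variable ord : seq nat.
Hypothesis pord : perm_eq ord (iota 0 n).
Local Notation row := (row_bit G ord).
Local Notation ends := (ends G ord).
Local Notation visited := (visited n ord).

Variables (rg0 m0 : nat -> nat) (src : nat).
Hypothesis bs0 : base rg0 m0.
Hypothesis hs0 : holds m0 3 ord.
Hypothesis he0 : forall x p, x < n -> p < n -> ends m0 x p.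
Hypothesis srcn : src < n.

Definition dist_row (m : nat -> nat) (y : nat) : nat := m (1 * NN + (src * n + y)).

Definition search_regs :=
  [:: 7; 9; 10; 11; 12; 13; 14; 15; 16; 17; 18; 19; 20; 21; 22; 23].

(** Array 1 is among those allowed to change, so the last clause is what protects the output rows of
    the other sources. *)
Definition frame (rg m : nat -> nat) : Prop :=
  [/\ eqregs search_regs rg0 rg, eqmem visit_mem m0 m, rg 9 = src * n
    & forall x y, x < n -> y < n -> x != src ->
        m (1 * NN + (x * n + y)) = m0 (1 * NN + (x * n + y))].

Definition verts (pq : seq nat) : seq nat := [seq nth 0 ord p | p <- pq].

Definition searching (rg m : nat -> nat) (pq : seq nat) (h b : nat) : Prop :=
  [/\ frame rg m, visited rg m pq & bfs n (adjn G) src (verts pq) (dist_row m) h b].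

(* The vertex at index [h] of the queue is being processed; [tk] lists the
   first [h + 1] positions of the queue, which do not change meanwhile. *)
Definition processing (h : nat) (tk : seq nat) (rg m : nat -> nat) (pq : seq nat)
    (b : nat) : Prop :=
  let x := nth 0 ord (nth 0 tk h) in
  [/\ searching rg m pq h b, rg 12 = x /\ rg 13 = b, b = (dist_row m x).+1,
      h < size pq /\ rg 10 = h.+1 & take h.+1 pq = tk].

Lemma frame_upd rg m r v : frame rg m -> r \in search_regs -> r != 9 ->
  frame (upd rg r v) m.
Proof.
move=> [er em r9 oth] rl rn; split=> //; first exact: eqregs_upd.
by rewrite /= eq_sym (negPf rn).
Qed.

Lemma frame_static rg m : frame rg m ->
  [/\ base rg m, holds m 3 ord & forall x p, x < n -> p < n -> ends m x p].
Proof.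
move=> [er em _ _]; split; first exact: base_frame bs0 er em isT isT isT.
  by apply: (holds_frame n1 hs0 em); rewrite ?(size_ord pord).
by move=> x p xn pn; rewrite /ends em ?index_lt //; apply: he0.
Qed.

(* Time reserved for future visits: a fixed cost per unvisited vertex, plus the
   relabellings that can still raise the potential of the union-find structure. *)
Definition vpot (m : nat -> nat) (pq : seq nat) : nat :=
  300 * (n - size pq) + 30 * (n.+1 * trunc_log 2 n.+1 - fpot n m).

Lemma adjn_lt x y : adjn G x y -> y < n.
Proof. by rewrite /adjn; case: insub => // u; case: insubP. Qed.

Lemma verts_mem pq r : (forall p, p \in pq -> p < n) -> r < n ->
  (nth 0 ord r \in verts pq) = (r \in pq).
Proof.
move=> lq rn; apply/mapP/idP => [[p pq_p e]|]; last by exists r.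
have uo : uniq ord by rewrite (perm_uniq pord) iota_uniq.
have [pn so] := (lq _ pq_p, size_ord pord).
by have /eqP := e; rewrite nth_uniq ?so // => /eqP->.
Qed.

(** A visit releases 300 units besides the relabelling budget and uses at most 200 of them; the
    margin of 90 pays for the loop test and the next find. *)
Lemma run_visit_searching rg m tp r pq h x b :
  searching rg m pq h b -> h < size pq -> x = nth 0 ord (nth 0 pq h) ->
  b = (dist_row m x).+1 -> rg 13 = b -> rg 16 = r -> r < n -> r \notin pq -> row x r ->
  run w visit_cmd (State rg m tp) (fun s' t => exists rg' m',
    [/\ s' = State rg' m' tp, eqregs visit_regs rg rg', searching rg' m' (rcons pq r) h b,
        b = (dist_row m' x).+1 & t + 90 + vpot m' (rcons pq r) <= vpot m pq]).
Proof.
move=> [fr vis bf] hs xE bE r13 r16 rn rq rowr.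
have [bs h3 _] := frame_static fr; have [er em r9 oth] := fr.
have [_ _ uq lq uf0] := vis.
apply: run_weaken; first exact: (run_visit n1 big pord _ bs h3 vis srcn r9 r16 rn rq r13).
move=> _ t [rg' [m' [-> er' em' le [vis' out]]]]; exists rg', m'.
set y := nth 0 ord r; have yn : y < n by apply: ord_lt.
have DE z : z < n -> dist_row m' z = if z == y then b else dist_row m z.
  by move=> zn; rewrite /dist_row out ?index_lt // eqn_add2l.
have yv : y \notin verts pq by rewrite verts_mem.
have xv : x \in verts pq by rewrite xE; apply: map_f; apply: mem_nth.
have xn : x < n := bfs_lt bf xv.
have nx : nth 0 (verts pq) h = x by rewrite (nth_map 0).
split=> //.
- split.
  + split=> //.
    * by apply: eqregs_sub (eqregs_trans er er') => i; rewrite !inE; lia.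
    * by apply: eqmem_sub (eqmem_trans em em') => i; rewrite !inE; lia.
    * by rewrite er'.
    move=> x' y' xn' yn' ne; rewrite out ?index_lt ?oth //.
    case: eqP => // e; move/eqP: ne; case; move: e; rewrite -/y => e; nia.
  + exact: vis'.
  rewrite /verts map_rcons; apply: bfs_visit (bf) _ _ _ _ DE => //.
  + exact: adjn_lt.
  + by rewrite size_map.
  + by rewrite nx.
  by rewrite nx.
- by rewrite DE //; case: eqP => // xy; rewrite -xy xv in yv.
have kn := size_visited uq lq rn rq.
have [_ _ _ _ uf'] := vis'.
have := uf_pot_le uf'; rewrite -/(fpot n m') => pM.
by rewrite /vpot size_rcons; lia.
Qed.

Lemma processing_upd h tk rg m pq b r v : processing h tk rg m pq b ->
  r \in [:: 14; 15; 16] -> processing h tk (upd rg r v) m pq b.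
Proof.
move=> [[fr [v1 v2 v3 v4 v5] bf] [p1 p2] p3 [p4 p5] p6] hr.
have rl : r \in search_regs by move: hr; rewrite !inE; lia.
have ne k : k \notin [:: 14; 15; 16] -> (k == r) = false.
  by move=> hk; apply: contraNF hk => /eqP->.
split; rewrite /= ?ne //; split=> //=; last by split; rewrite /= ?ne.
by apply: frame_upd => //; rewrite eq_sym ne.
Qed.

Lemma processing_lt h tk rg m pq b : processing h tk rg m pq b ->
  nth 0 ord (nth 0 tk h) < n /\ nth 0 tk h \in pq.
Proof.
move=> [[_ _ bf] _ _ [hs _] <-]; rewrite nth_take //; split; last exact: mem_nth.
by apply: (bfs_lt bf); apply: map_f; apply: mem_nth.
Qed.

Lemma next_unvisited rg m pq p : visited rg m pq -> p <= n ->
  let r := m (7 * NN + m (5 * NN + p)) in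
  [/\ m (5 * NN + p) < NN, p <= r, r <= n, r \notin pq
    & forall q, p <= q < r -> q \in pq].
Proof.
move=> [_ _ _ _ u] pn; have [h1 h2 h3 h4] := uf_next u pn.
by have [lp _ _ _ _] := u p pn; split=> //; apply: n_lt_NN.
Qed.

(** All iterations are charged to the vertices they visit, so the remaining cost is constant,
    whatever the length of the run. *)
Lemma run_run h tk rg m tp pq b p e : processing h tk rg m pq b ->
  rg 14 = p -> p < n -> rg 15 = e -> e <= n ->
  (forall q, p <= q < e -> row (nth 0 ord (nth 0 tk h)) q) ->
  run w run_cmd (State rg m tp) (fun s' t => exists rg' m' pq',
    [/\ s' = State rg' m' tp, processing h tk rg' m' pq' b, rg' 14 = p /\ rg' 15 = e,
        {subset pq <= pq'} /\ (forall q, p <= q < e -> q \in pq')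
      & t + vpot m' pq' <= vpot m pq + 40]).
Proof.
move=> pr r14 pn r15 en rows; have pr0 := pr.
have nNN := n_lt_NN n1 (leqnn n); have B1 := word_gt1 n1 big.
set x := nth 0 ord _ in rows.
have [[fr vis bf] _ _ _ _] := pr; have [[r0 r1 _] _ _] := frame_static fr.
have [l5 pr_ rn rq hq] := next_unvisited vis (ltnW pn).
apply: run_seq; apply: run_assign; first by rewrite /= r1 r14; fit.
rewrite /= r1 r14.
pose I pq' st := exists rg' m', [/\ st = State rg' m' tp, processing h tk rg' m' pq' b,
  rg' 14 = p /\ rg' 15 = e, {subset pq <= pq'} &
  exists r, [/\ rg' 16 = r, p <= r <= n, r \notin pq' & forall q, p <= q < r -> q \in pq']].
apply: run_weaken.
  apply: (@run_while w (seq nat) I (fun pq' st => vpot (memory st) pq') _ _ pq).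
  - by move=> pq' _ [rg' [m' [-> _ _ _ _]]] /=; fit.
  - move=> pq' _ [rg1 [m1 [-> pr1 [r141 r151] sub1 [r [r161 /andP[lr rn'] rq' hq']]]]].
    rewrite /= r161 r151 => lt; have {}lt : r < e by case: ltnP lt.
    have [se [r121 r131] bE [hs r101] tkE] := pr1.
    have xE : x = nth 0 ord (nth 0 pq' h) by rewrite /x -tkE nth_take.
    apply: run_seq; apply: run_weaken.
      apply: (run_visit_searching _ se hs xE bE r131 r161 _ rq'); first by lia.
      by apply: rows; lia.
    move=> _ t [rg2 [m2 [-> er2 se2 bE2 le2]]].
    have pr2 : processing h tk rg2 m2 (rcons pq' r) b.
      split=> //; rewrite ?er2 //; first by split=> //; rewrite size_rcons ltnW.
      by rewrite -cats1 takel_cat.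
    have [fr2 vis2 bf2] := se2; have [[r02 r12 _] _ _] := frame_static fr2.
    have [l52 lr2 rn2 rq2 hq2] := next_unvisited vis2 (ltnW (leq_trans lt en)).
    have r162 : rg2 16 = r by rewrite er2.
    apply: run_assign; first by rewrite /= r12 r162; fit.
    exists (rcons pq' r); last by rewrite /=; lia.
    rewrite /= r12 r162; eexists; exists m2; split; [by []|exact: processing_upd| | |].
    + by rewrite /= !er2.
    + by move=> q /sub1; rewrite mem_rcons inE orbC => ->.
    eexists; split=> //=; first by lia.
    move=> q hq2'; have [qr|qr] := ltnP q r; last by apply: hq2; lia.
    by rewrite mem_rcons inE hq' ?orbT //; lia.
  exists (upd rg 16 (m (7 * NN + m (5 * NN + p)))), m; split=> //=.
    exact: processing_upd.
  by eexists; split=> //; rewrite pr_.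
move=> _ t [pq' [rg' [m' [-> pr' [r14' r15'] sub' [r [r16' _ _ hq']]]]] []].
rewrite /= r16' r15' => /eqP; rewrite eqb0 -leqNgt => er le.
exists rg', m', pq'; split=> //; last by move: le => /=; lia.
by split=> // q hq2; apply: hq'; lia.
Qed.

(** Each jump to a run end uses up one run ([runs_from_next]), which pays the fixed cost of the
    round; visits are paid from [vpot]. *)
Lemma run_scan h tk rg m tp pq b : processing h tk rg m pq b ->
  run w scan_cmd (State rg m tp) (fun s' t => exists rg' m' pq',
    [/\ s' = State rg' m' tp, processing h tk rg' m' pq' b,
        (forall q, q < n -> row (nth 0 ord (nth 0 tk h)) q -> q \in pq')
      & t + vpot m' pq' <=
        vpot m pq + 120 * runs_from n (row (nth 0 ord (nth 0 tk h))) 0 + 20]).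
Proof.
move=> pr; have [xn _] := processing_lt pr; set x := nth 0 ord _ in xn *.
have nNN := n_lt_NN n1 (leqnn n); have B1 := word_gt1 n1 big.
apply: run_seq; apply: run_assign; first by rewrite /=; lia.
pose I (g : nat * seq nat) st := exists rg' m', [/\ st = State rg' m' tp,
  processing h tk rg' m' g.2 b, rg' 14 = g.1, g.1 <= n &
  forall q, q < g.1 -> row x q -> q \in g.2].
pose pot (g : nat * seq nat) st := vpot (memory st) g.2 + 120 * runs_from n (row x) g.1.
apply: run_weaken.
  apply: (@run_while w _ I pot _ _ (0, pq)).
  - by move=> g _ [rg' [m' [-> _ _ _ _]]] /=; fit.
  - move=> [p pq'] _ [rg1 [m1 [-> /= pr1 r14 _ hq]]].
    have [[fr1 vis1 bf1] [r12 r13] bE [hs r10] tkE] := pr1.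
    have [[r0 r1 m0'] h3 he] := frame_static fr1; rewrite -/x in r12.
    rewrite r14 r0 => lt; have {}lt : p < n by case: ltnP lt.
    have oN := ord_lt pord lt; have ixp := index_lt xn lt; have ixo := index_lt xn oN.
    have [jb same nx] := he x p xn lt; have re : ends m1 x p := he x p xn lt.
    set e := m1 (2 * NN + (x * n + p)) in jb same nx re.
    have m3 : m1 (3 * NN + p) = nth 0 ord p by rewrite h3 ?(size_ord pord).
    apply: run_seq; apply: run_assign; first by rewrite /= r0 r1 r12 r14; fit.
    rewrite /= r0 r1 r12 r14 -/e.
    have pr2 : processing h tk (upd rg1 15 e) m1 pq' b by apply: processing_upd.
    have mid : run w (If (rd 0 (add (mul (Reg 12) (Reg 0)) (rd 3 (Reg 14)))) run_cmd Skip)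
        (State (upd rg1 15 e) m1 tp) (fun s' t => exists rg' m' pq2,
      [/\ s' = State rg' m' tp, processing h tk rg' m' pq2 b, rg' 15 = e,
          {subset pq' <= pq2} /\ (forall q, p <= q < e -> row x q -> q \in pq2)
        & t + vpot m' pq2 <= vpot m1 pq' + 70]).
      apply: run_if; first by rewrite /= r0 r1 r12 r14 m3; fit.
      rewrite /= r0 r1 r12 r14 m3 m0' // -[adjn G x _]/(row x p).
      case: (boolP (row x p)) => rp /=.
        apply: run_weaken.
          apply: (run_run _ pr2 (p := p) (e := e)) => //=; first by lia.
          by move=> q hq2; rewrite same.
        move=> _ t [rg' [m' [pq2 [-> pr' [_ r15'] [sub' hq2] le]]]].
        exists rg', m', pq2; split=> //; last by lia.
        by split=> // q hq3 _; apply: hq2.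
      apply: run_skip; exists (upd rg1 15 e), m1, pq'; split=> //; last by lia.
      by split=> // q hq2; rewrite same // (negPf rp).
    apply: run_seq; apply: run_weaken mid _.
    move=> _ t [rg3 [m3' [pq3 [-> pr3 r153 [sub3 hq3] le3]]]].
    apply: run_assign => //; exists (e, pq3); last first.
      by have := runs_from_next re; rewrite -/e /pot /=; lia.
    rewrite /= r153; eexists; exists m3'; split; [by []|exact: processing_upd|by []|by rewrite /=; lia|].
    move=> q /= qe rq; have [qp|qp] := ltnP q p; first by apply/sub3/hq.
    by apply: hq3 => //; lia.
  exists (upd rg 14 0), m; split=> //=; exact: processing_upd.
move=> _ t [[p pq'] [rg' [m' [-> /= pr' r14' pn hq]]] []].
have [[fr' _ _] _ _ _ _] := pr'; have [[r0' _ _] _ _] := frame_static fr'.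
rewrite r14' r0' => /eqP; rewrite eqb0 -leqNgt => np.
have {}np : p = n by lia.
rewrite np in hq *; rewrite /pot /= => le.
exists rg', m', pq'; split=> //; lia.
Qed.

(** Budget for the scans to come: a vertex is processed at most once per search, so only rows
    outside the processed prefix count. At the start it is the number of runs of the whole reordered
    matrix. *)
Definition rest (h : nat) (pq : seq nat) : nat :=
  \sum_(q < n | val q \notin take h pq) runs_from n (row (nth 0 ord q)) 0.

Lemma restS h pq pq' : uniq pq -> (forall p, p \in pq -> p < n) -> h < size pq ->
  take h.+1 pq' = take h.+1 pq ->
  rest h.+1 pq' + runs_from n (row (nth 0 ord (nth 0 pq h))) 0 = rest h pq.
Proof.
move=> uq lq hs tkE; set q := nth 0 pq h.
have qn : q < n by apply/lq/mem_nth.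
have tkS : take h.+1 pq = rcons (take h pq) q by rewrite (take_nth 0).
have : uniq (rcons (take h pq) q) by rewrite -tkS take_uniq.
rewrite rcons_uniq => /andP[qN _].
rewrite /rest [RHS](bigD1 (Ordinal qn)) //= addnC; congr (_ + _).
by apply: eq_bigl => i; rewrite tkE tkS mem_rcons inE negb_or andbC.
Qed.

Definition dist_spec (v y : nat) : Prop :=
  (walk (adjn G) src y v /\
   forall p, path (adjn G) src p -> last src p = y -> v <= size p) \/
  (v = n /\ forall p, path (adjn G) src p -> last src p <> y).

Lemma run_search rg m tp ps : searching rg m [:: ps] 0 0 ->
  run w search_cmd (State rg m tp) (fun s' t => exists rg' m',
    [/\ s' = State rg' m' tp, frame rg' m',
        forall y, y < n -> dist_spec (dist_row m' y) y
      & t <= vpot m [:: ps] + 250 * rest 0 [::] + 20]).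
Proof.
move=> se0; have nNN := n_lt_NN n1 (leqnn n); have B1 := word_gt1 n1 big.
apply: run_seq; apply: run_assign; first by rewrite /=; lia.
pose I (g : nat * seq nat) st := exists rg' m' b, [/\ st = State rg' m' tp,
  searching rg' m' g.2 g.1 b, rg' 10 = g.1 &
  g.1 < size g.2 -> b <= (dist_row m' (nth 0 (verts g.2) g.1)).+1].
pose pot (g : nat * seq nat) st := vpot (memory st) g.2 + 250 * rest g.1 g.2.
apply: run_weaken.
  apply: (@run_while w _ I pot _ _ (0, [:: ps])).
  - by move=> g _ [rg' [m' [b [-> _ _ _]]]] /=; fit.
  - move=> [h pq] _ [rg1 [m1 [b [-> /= se r10 hb]]]].
    have [fr [r11 h8 uq lq _] bf] := se; have [[r0 r1 _] h3 _] := frame_static fr.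
    have [_ _ r9 _] := fr.
    rewrite r10 r11 => lt; have {}lt : h < size pq by case: ltnP lt.
    set x := nth 0 ord (nth 0 pq h).
    have vh : nth 0 (verts pq) h = x by rewrite (nth_map 0).
    have hv : h < size (verts pq) by rewrite size_map.
    have xn : x < n by rewrite -vh; apply/(bfs_lt bf)/mem_nth.
    have hn : h < n.
      have := uniq_leq_size uq (_ : {subset pq <= iota 0 n}); rewrite size_iota => sn.
      by apply: leq_trans lt (sn _) => z /lq; rewrite mem_iota.
    have hN := n_lt_NN n1 (ltnW hn); have ix := index_lt srcn xn.
    have m8 : m1 (8 * NN + h) = x by rewrite h8 // vh.
    (* The label of a head at queue index [h] is at most h < n, so the incremented label fits in a
       word. *)
    have Dx : dist_row m1 x <= h by rewrite -vh; apply: bfs_small bf _ _.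
    apply: run_seq; apply: run_assign; first by rewrite /= r1 r10; fit.
    rewrite /= r1 r10 m8.
    apply: run_seq; apply: run_assign; first by rewrite /= r10; fit.
    rewrite /= r10 addn1.
    apply: run_seq; apply: run_assign.
      by rewrite /= r1 r9 -/(dist_row m1 x); fit.
    rewrite /= r1 r9 -/(dist_row m1 x) addn1.
    set b' := (dist_row m1 x).+1; set rg2 := upd _ 13 b'.
    have bf' : bfs n (adjn G) src (verts pq) (dist_row m1) h b'.
      by apply: bfs_weaken bf _; rewrite /b' -vh hb.
    have xE : nth 0 ord (nth 0 (take h.+1 pq) h) = x by rewrite nth_take.
    have pr : processing h (take h.+1 pq) rg2 m1 pq b'.
      split; rewrite /= ?xE //; split=> //; last by case: se.
      by do 3! apply: frame_upd => //.
    apply: run_weaken; first exact: (run_scan _ pr).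
    move=> _ t [rg3 [m3 [pq3 [-> pr3 nb le3]]]]; rewrite xE in nb le3.
    have [[fr3 vis3 bf3] _ bE3 [hs3 r103] tk3] := pr3; rewrite xE in bE3.
    have vh3 : nth 0 (verts pq3) h = x by rewrite (nth_map 0) // -xE -tk3 nth_take.
    have hv3 : h < size (verts pq3) by rewrite size_map.
    have bf4 : bfs n (adjn G) src (verts pq3) (dist_row m3) h.+1 b'.
      apply: bfs_next bf3 hv3 _ _; rewrite vh3 // => y xy.
      have yo : y \in ord by rewrite (perm_mem pord) mem_iota; apply: adjn_lt xy.
      rewrite -(nth_index 0 yo); apply: map_f; apply: nb.
        by rewrite -(size_ord pord) index_mem.
      by rewrite /row_bit nth_index.
    exists (h.+1, pq3).
      (* The next head has a label at least that of [x], the queue being sorted; hence [b'] can be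
         raised to the bound required when that head is processed. *)
      exists rg3, m3, b'; split=> //= hs4; rewrite bE3 ltnS -vh3.
      by apply: bfs_sorted bf4 _ _ _ _ => //; rewrite size_map.
    have rst := restS uq lq lt tk3; rewrite -/x in rst.
    (* Every row has a run, to which the fixed cost of processing a vertex is charged. *)
    have r1' : 0 < runs_from n (row x) 0 by rewrite /runs_from (ltnW n1).
    by rewrite /pot /= -rst; lia.
  exists (upd rg 10 0), m, 0; split=> //=.
  by have [fr vis bf] := se0; split=> //; apply: frame_upd.
move=> _ t [[h pq] [rg' [m' [b [-> /= se r10 hb]]]] []].
have [fr [r11 _ _ lq _] bf] := se.
rewrite r10 r11 => /eqP; rewrite eqb0 -leqNgt => sh; rewrite /pot /= => le.
have hE : h = size (verts pq).
  by have := bfs_head bf; rewrite size_map in sh * => ?; lia.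
rewrite hE in bf.
exists rg', m'; split=> //; last first.
  have -> : rest 0 [::] = rest 0 [:: ps] by rewrite /rest !take0.
  by lia.
move=> y yn; have [yv|yv] := boolP (y \in verts pq).
  left; split; first exact: bfs_walk bf _ yv.
  by move=> p pp <-; have [] := bfs_complete bf pp.
right; split; first exact: bfs_inf bf _ yn yv.
by move=> p pp e; have [] := bfs_complete bf pp; rewrite e (negPf yv).
Qed.

Lemma run_source tp ps : rg0 5 = ps -> ps < n -> src = nth 0 ord ps ->
  run w source_cmd (State rg0 m0 tp) (fun s' t => exists rg' m',
    [/\ s' = State rg' m' tp, frame rg' m',
        forall y, y < n -> dist_spec (dist_row m' y) y
      & t <= 30 * (n.+1 * trunc_log 2 n.+1) + 250 * rest 0 [::] + 1000 * n]).
Proof.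
move=> r5 psn srcE; have nNN := n_lt_NN n1 (leqnn n); have B1 := word_gt1 n1 big.
have nB := word_gtn n1 big (leqnn n); have [r0 r1 m00] := bs0.
have pNN := n_lt_NN n1 (ltnW psn).
have m3 : m0 (3 * NN + ps) = src by rewrite hs0 ?(size_ord pord).
have srcN : src * n < NN by have := index_lt srcn srcn; lia.
apply: run_seq; apply: run_assign; first by rewrite /= r0 r1 r5 m3; fit.
rewrite /= r0 r1 r5 m3.
apply: run_seq; apply: run_assign; first by rewrite /=; lia.
rewrite /=; set rg1 := upd (upd _ _ _) 7 0.
have fr1 : frame rg1 m0 by split=> //; do 2! apply: eqregs_upd => //.
pose I i st := exists rg' m', [/\ st = State rg' m' tp, rg' 7 = i, frame rg' m' &
  forall y, y < i -> dist_row m' y = n].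
apply: run_seq; apply: (@run_for w I n 40 _ _ _ 0) => //.
- move=> i _ [rg' [m' [-> r7 fr _]]] /=.
  by have [[-> _ _] _ _] := frame_static fr.
- move=> i _ ni [rg' [m' [-> r7 fr h]]].
  have [[r0' r1' _] _ _] := frame_static fr; have [er em r9' oth] := fr.
  have isr := index_lt srcn ni.
  apply: (run_st n1 big) => //=; rewrite ?r9' ?r7 ?r0' //; first by fit.
  move=> m'' wr; split=> //; exists (upd rg' 7 i.+1), m''; split=> //.
    apply: frame_upd => //; split=> //; first exact: eqmem_write em wr _.
    move=> x y xn yn ne; rewrite wr ?index_lt //= oth //.
    by case: eqP => // e; move/eqP: ne; case; nia.
  move=> y; rewrite ltnS => yi; rewrite /dist_row wr /=; last by apply: index_lt => //; lia.
  rewrite eqn_add2l; case: eqP => // ne; apply: h; lia.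
- by exists rg1, m0; split.
move=> _ t1 [rg2 [m2 [-> r72 fr2 h2]]] le1.
apply: run_seq; apply: run_assign; first by rewrite /=; lia.
rewrite /=.
pose J i st := exists rg' m', [/\ st = State rg' m' tp, rg' 7 = i, frame rg' m',
  forall y, y < n -> dist_row m' y = n &
  forall p, p < i -> [/\ labs n m' p = p, los n m' p = p & his n m' p = p]].
apply: run_seq; apply: (@run_for w J n.+1 60 _ _ _ 0) => //.
- by lia.
- move=> i _ [rg' [m' [-> r7 fr _ _]]] /=.
  by have [[-> _ _] _ _] := frame_static fr; rewrite addn1; split=> //; fit.
- move=> i _ ni [rg' [m' [-> r7 fr hd h]]].
  have [[r0' r1' _] _ _] := frame_static fr; have [er em r9' oth] := fr.
  have iN := n_lt_NN n1 ni.
  apply: run_seq; apply: (run_st n1 big) => //=; rewrite ?r7 // => m5 wr5.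
  apply: run_seq; apply: (run_st n1 big) => //=; rewrite ?r7 // => m6 wr6.
  apply: (run_st n1 big) => //=; rewrite ?r7 // => m7 wr7.
  split=> //; exists (upd rg' 7 i.+1), m7; split=> //.
  + apply: frame_upd => //; split=> //.
      by do 3! (apply: eqmem_write; [|eassumption|by []]).
    by move=> x y xn yn ne; rewrite wr7 ?wr6 ?wr5 ?index_lt //= oth.
  + by move=> y yn; rewrite /dist_row wr7 ?wr6 ?wr5 ?index_lt //=; apply: hd.
  move=> p; rewrite ltnS => pi; have pN : p < NN by lia.
  rewrite /labs /los /his !wr7 ?wr6 ?wr5 //=.
  by case: eqP => [->//|ne]; apply: h; lia.
- by exists (upd rg2 7 0), m2; split=> //; apply: frame_upd.
move=> _ t2 [rg3 [m3' [-> r73 fr3 h3 huf]]] le2.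
apply: run_seq; apply: run_assign; first by rewrite /=; lia.
apply: run_seq; apply: run_assign; first by rewrite /=; lia.
apply: run_seq; apply: run_assign => //=.
have r53 : rg3 5 = ps by have [er _ _ _] := fr3; rewrite er.
rewrite r53; set rg4 := upd _ 16 ps.
have fr4 : frame rg4 m3' by do 3! apply: frame_upd => //.
have [bs4 hs4 _] := frame_static fr4; have [er4 em4 r94 oth4] := fr4.
have vis4 : visited rg4 m3' [::] by split=> //; apply: uf_init.
apply: run_seq; apply: run_weaken.
  exact: (run_visit n1 big pord _ bs4 hs4 vis4 srcn r94 (r := ps) (d := 0)).
move=> _ t3 [rg5 [m5 [-> er5 em5 le3 [vis5 out]]]]; rewrite -srcE in out.
have fr5 : frame rg5 m5.
  split.
  - by apply: eqregs_sub (eqregs_trans er4 er5) => i; rewrite !inE; lia.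
  - by apply: eqmem_sub (eqmem_trans em4 em5) => i; rewrite !inE; lia.
  - by rewrite er5.
  move=> x y xn yn ne; rewrite out ?index_lt ?oth4 //.
  by case: eqP => // e; move/eqP: ne; case; nia.
have bf5 : bfs n (adjn G) src (verts [:: ps]) (dist_row m5) 0 0.
  rewrite /verts /= -srcE; apply: bfs_init => //.
    by rewrite /dist_row out ?eqxx ?index_lt.
  move=> y yn ne; rewrite /dist_row out ?index_lt // eqn_add2l (negPf ne).
  exact: h3.
apply: run_weaken; first exact: (@run_search rg5 m5 tp ps).
move=> _ t4 [rg6 [m6 [-> fr6 ds le4]]]; exists rg6, m6; split=> //.
have [_ _ _ _ uf5] := vis5; have := uf_pot_le uf5; rewrite -/(fpot n m5) => pM.
by move: le1 le2 le3 le4; rewrite /vpot /=; lia.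
Qed.

End Source.

(** * Arithmetic of the total running time *)

Lemma distr2 k n c1 c2 : k * (c1 * n + c2) = c1 * (k * n) + c2 * k.
Proof. lia. Qed.

Lemma distr3 X a b c1 c2 c3 :
  (c1 + c2 * a + c3 * b * a) * X = c1 * X + c2 * (a * X) + c3 * (b * a * X).
Proof. lia. Qed.

Lemma distr4 n A S c1 c2 c3 c4 : n * (c1 * A + c2 * (n + S) + c3 * n + c4) =
  c1 * (n * A) + c2 * (n * n) + c2 * (n * S) + c3 * (n * n) + c4 * n.
Proof. lia. Qed.

(** Sorting and union-find cost order n^2 L for fixed [a]; only the scans, n times the run count
    [S], reach n^2 L^2. *)
Lemma apsp_time_bound n L a b S l t1 t2 t3 t4 :
  1 < n -> 0 < L -> l <= L -> S <= L.+1 * (b * (a * (n * L))) ->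
  t1 <= 100 * n + 100 -> t2 <= a * (n * L) * (180 * n + 120) + 10 ->
  t3 <= n * (120 * n + 120) + 20 ->
  t4 <= n * (30 * (n.+1 * l) + 250 * (n + S) + 1000 * n + 20) + 20 ->
  (t1 + (t2 + (t3 + t4).+1).+1).+1 <=
    (3000 + 300 * a + 500 * b * a) * (n ^ 2 * L ^ 2).
Proof.
move=> n1 L0 lL hS le1 le2 le3 le4.
have LL : L.+1 <= 2 * L by lia.
set X := n ^ 2 * L ^ 2; have XE : X = n * n * L * L by rewrite /X -!mulnn mulnA.
have LX : n * n * L <= X by rewrite XE leq_pmulr.
have nX : n * n <= n * n * L by rewrite leq_pmulr.
have n2 : 2 * n <= n * n by rewrite leq_mul2r n1 orbT.
have h1 : n * (n.+1 * l) <= 2 * X.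
  apply: (@leq_trans (n * (2 * n * L))).
    by rewrite leq_mul2l leq_mul ?orbT //; lia.
  by rewrite mulnA mulnCA -!mulnA leq_mul2l /= mulnA.
have h2 : n * S <= 2 * (b * a * X).
  apply: (@leq_trans (n * (2 * L * (b * (a * (n * L)))))).
    by rewrite leq_mul2l (leq_trans hS) ?orbT // leq_mul2r LL orbT.
  by apply/eqnP; rewrite XE; lia.
have h3 : a * (n * L) * n <= a * X.
  by rewrite -mulnA leq_mul2l mulnAC LX orbT.
have h4 : a * (n * L) <= a * (n * L) * n by rewrite leq_pmulr //; lia.
rewrite distr2 in le2; rewrite distr2 in le3; rewrite distr4 in le4; rewrite distr3.
(* All products are now atoms, compared with [X] by the hypotheses above, which leaves a linear
   problem. *)
clearbody X; move: X (n * n) (a * (n * L)) (n * (n.+1 * l)) (n * S) (a * X) (b * a * X)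
  (n * n * L) (a * (n * L) * n) {XE hS} h1 h2 h3 h4 LX nX n2 le1 le2 le3 le4.
lia.
Qed.

(** * The theorem *)

Definition sources_cmd : cmd :=
  Seq (Assign 5 (Cst 0)) (for_loop 5 (Reg 0) source_cmd).

Definition apsp_cmd (a : nat) : cmd :=
  Seq (setup_cmd a) (Seq sort_cmd (Seq ends_cmd sources_cmd)).

Lemma path_adjn n (G : sgraph n) (u : 'I_n) (p : seq nat) : path (adjn G) u p ->
  exists2 p' : seq 'I_n, p = map val p' & path G u p'.
Proof.
elim: p u => [|y p IH] u /=; first by exists [::].
case/andP=> uy /[dup] pp; have yn := adjn_lt uy.
have e : y = val (Ordinal yn) by []; rewrite e in uy *.
move=> /IH [p' -> pp']; exists (Ordinal yn :: p') => //=.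
by rewrite pp' -adjnE uy.
Qed.

Lemma path_adjn_map n (G : sgraph n) (u : 'I_n) (p : seq 'I_n) :
  path (adjn G) u (map val p) = path G u p.
Proof. by elim: p u => //= y p IH u; rewrite IH adjnE. Qed.

Lemma dist_spec_output n (G : sgraph n) (u v : 'I_n) k : dist_spec G u k v ->
  if connect G u v then is_dist G u v k else k = n.
Proof.
case=> [[[p [pp lp <-]] mn]|[-> no]].
  have [p' pE pp'] := path_adjn pp; rewrite pE last_map in lp.
  have lp' : last u p' = v by apply: val_inj.
  have -> : connect G u v by apply/connectP; exists p'.
  split; first by exists p'; rewrite pE size_map.
  move=> q pq lq; rewrite -(size_map val); apply: mn; rewrite ?path_adjn_map //.
  by rewrite last_map lq.
case: ifP => // /connectP [p pp lp]; exfalso.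
by apply: (no (map val p)); rewrite ?path_adjn_map // last_map -lp.
Qed.

Section Main.
Variables (n : nat) (G : sgraph n) (w : nat).
Hypothesis n1 : 1 < n.
Hypothesis big : 16 * (n * n) < 2 ^ w.
Local Notation NN := (n * n).

(** Every row has one run more than it has breaks, and summing along [ord] is summing over all
    vertices. *)
Lemma rest_all ord : perm_eq ord (iota 0 n) ->
  rest G ord 0 [::] = n + \sum_(x < n) breaks (adjn G x) ord.
Proof.
move=> po; have so := size_ord po.
have sum_ord F : \sum_(q < n) F (nth 0 ord q) = \sum_(x < n) F x.
  rewrite -[RHS](big_mkord predT F) /index_iota subn0 -(perm_big _ po) /=.
  by rewrite (big_nth 0) so big_mkord.
rewrite /rest (eq_bigl predT) //.
rewrite (sum_ord (fun x => runs_from n (row_bit G ord x) 0)).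
have nE : n = \sum_(x < n) 1 by rewrite sum1_card card_ord.
rewrite [X in _ = X + _]nE -big_split /=; apply: eq_bigr => x _.
by rewrite /runs_from (ltnW n1) /breaks so.
Qed.

(** The distances are right for any permutation [ord]; the quality of the order enters only through
    [rest] in the time bound. *)
Lemma run_sources rg m tp ord (C := 30 * (n.+1 * trunc_log 2 n.+1) +
    250 * rest G ord 0 [::] + 1000 * n) :
  perm_eq ord (iota 0 n) -> base G rg m -> holds n m 3 ord ->
  (forall x p, x < n -> p < n -> ends G ord m x p) ->
  run w sources_cmd (State rg m tp) (fun s' t =>
    (forall x y, x < n -> y < n ->
       dist_spec G x (memory s' (1 * NN + (x * n + y))) y) /\
    t <= n * (C + 20) + 20).
Proof.
move=> po bs hs he; have so := size_ord po.
have nB := word_gtn n1 big (leqnn n); have B1 := word_gt1 n1 big.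
pose I i st := exists rg' m', [/\ st = State rg' m' tp, rg' 5 = i,
  eqregs (5 :: search_regs) rg rg', eqmem n visit_mem m m' &
  forall ps y, ps < i -> y < n -> dist_spec G (nth 0 ord ps)
     (m' (1 * NN + (nth 0 ord ps * n + y))) y].
apply: run_seq; apply: run_assign; first by rewrite /=; lia.
apply: (@run_for w I n (C + 20) _ _ _ 0) => //.
- move=> i _ [rg' [m' [-> r5 er em _]]] /=.
  by have [-> _ _] := base_frame bs er em isT isT isT.
- move=> i _ ni [rg1 [m1 [-> r5 er em h]]].
  have bs1 := base_frame bs er em isT isT isT.
  have hs1 : holds n m1 3 ord by apply: (holds_frame n1 hs em); rewrite ?so.
  have he1 x p : x < n -> p < n -> ends G ord m1 x p.
    by move=> xn pn; rewrite /ends em ?index_lt //; apply: he.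
  have sn := ord_lt po ni.
  apply: run_weaken; first exact: (run_source n1 big po bs1 hs1 he1 sn tp r5 ni erefl).
  move=> _ t [rg2 [m2 [-> [er2 em2 r9 oth] ds le]]].
  split; [by rewrite /=; lia|by rewrite /= er2|].
  exists (upd rg2 5 i.+1), m2; split=> //.
  + apply: eqregs_upd => //.
    by apply: eqregs_sub (eqregs_trans er er2) => r; rewrite mem_cat => /orP[//|rs]; rewrite inE rs orbT.
  + by apply: eqmem_sub (eqmem_trans em em2) => r; rewrite mem_cat orbb.
  move=> ps y; rewrite ltnS leq_eqVlt => /orP[/eqP->|psi] yn; first exact: ds.
  have uo : uniq ord by rewrite (perm_uniq po) iota_uniq.
  have psn : ps < n by apply: ltn_trans psi ni.
  rewrite oth ?ord_lt //; first exact: h.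
  by rewrite nth_uniq ?so // neq_ltn psi.
- exists (upd rg 5 0), m; split=> //; exact: eqregs_upd.
move=> _ t [rg' [m' [-> _ _ _ h]]] le; split; last by move: le => /=; lia.
move=> x y xn yn.
have xo : x \in ord by rewrite (perm_mem po) mem_iota.
have xi : index x ord < n by rewrite -so index_mem.
by have := h _ y xi yn; rewrite nth_index.
Qed.

Lemma run_apsp a d tp (L := up_log 2 n) (N := a * (n * L)) :
  twin_width_le G d -> N < 2 ^ w -> separating G (sampled_columns n N tp) ->
  run w (apsp_cmd a) (init_state G tp) (fun s' t =>
    apsp_output G (memory s') /\
    t <= (3000 + 300 * a + 500 * (d.+1 * 2 ^ d.+2) * a) * (n ^ 2 * L ^ 2)).
Proof.
move=> tw NB sep; set B := d.+1 * _.
have n0 : 0 < n by lia.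
have L0 : 0 < L by rewrite up_log_gt0.
have nL : n <= 2 ^ L by apply: up_logP.
apply: run_seq; apply: run_weaken; first exact: (run_setup G n1 big tp NB).
move=> _ t1 [rg1 [m1 [-> bs1 r4 le1 h31]]].
apply: run_seq; apply: run_weaken; first exact: (run_sort n1 big tp bs1 r4 NB h31).
move=> _ t2 [rg2 [m2 [tp2 [-> er2 em2 le2 h32]]]].
set cols := sampled_columns n N tp in sep h32 *; set ord := radix G cols in h32.
have szc : size cols = N by rewrite size_mkseq.
have po : perm_eq ord (iota 0 n) by apply: perm_radix.
have bs2 := base_frame bs1 er2 em2 isT isT isT.
apply: run_seq; apply: run_weaken; first exact: (run_ends n1 big po tp2 bs2 h32).
move=> _ t3 [rg3 [m3 [-> er3 em3 le3 he3]]].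
have bs3 := base_frame bs2 er3 em3 isT isT isT.
have h33 : holds n m3 3 ord by apply: (holds_frame n1 h32 em3); rewrite ?(size_ord po).
apply: run_weaken; first exact: (run_sources tp2 po bs3 h33 he3).
move=> s4 t4 [out le4]; split.
  by move=> u v; apply: dist_spec_output; rewrite -[NN in memory s4 (NN + _)]mul1n; apply: out.
have cn : all (fun c => c < n) cols.
  by apply/allP => c /mapP[i _ ->]; rewrite ltn_mod.
have := sum_breaks_radix tw n0 nL cn sep; rewrite szc -/B -/ord => sb.
have tl : trunc_log 2 n.+1 <= L.
  rewrite -ltnS -(ltn_exp2l (m := 2)) //.
  have /andP[lo _] := trunc_log_bounds (isT : 1 < 2) (isT : 0 < n.+1).
  apply: leq_ltn_trans lo _; rewrite expnS.
  by have := ltn_exp2l 0 L (isT : 1 < 2); rewrite L0 expn0; lia.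
rewrite (rest_all po) in le4; rewrite -/N in le2.
exact: apsp_time_bound n1 L0 tl sb le1 le2 le3 le4.
Qed.

End Main.

(** With [l] the binary length of [n], the (a + 5) l bits split into 2 l for n^2, 3 l giving a
    factor of at least 64 for the nine arrays, and a l giving a factor above [a] for the number of
    samples. *)
Lemma word_length_large a n (w := word_length (a + 5) n) : 1 < n ->
  16 * (n * n) < 2 ^ w /\ a * (n * up_log 2 n) < 2 ^ w.
Proof.
move=> n1; set l := (trunc_log 2 n).+1.
have nl : n < 2 ^ l by have /andP[] := trunc_log_bounds (isT : 1 < 2) (ltnW n1).
have nn : n * n < 2 ^ l * 2 ^ l by apply: ltn_mul.
have l4 : 4 <= 2 ^ l.
  by rewrite -[4]/(2 ^ 2) leq_exp2l // ltnS trunc_log_gt0.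
have wE : 2 ^ w = (2 ^ l) ^ a * (2 ^ l) ^ 3 * (2 ^ l * 2 ^ l).
  by rewrite /w /word_length -/l mulnC expnM mulnn -!expnD -addnA.
have p3 : 4 ^ 3 <= (2 ^ l) ^ 3 by rewrite leq_exp2r.
have pa : a < (2 ^ l) ^ a.
  by apply: ltn_expl; apply: leq_trans l4.
have Ln : up_log 2 n <= n by apply: up_log_min => //; apply: ltnW; apply: ltn_expl.
have pa0 : 0 < (2 ^ l) ^ a by apply: leq_ltn_trans pa.
rewrite wE; move: (2 ^ l * 2 ^ l) ((2 ^ l) ^ a) ((2 ^ l) ^ 3) nn p3 pa pa0 => M A C.
move=> nn p3 pa pa0; split.
  apply: (@leq_trans (16 * M)); first by rewrite ltn_mul2l.
  rewrite leq_mul2r; apply/orP; right; apply: leq_trans (leq_pmull _ pa0).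
  by apply: leq_trans p3.
apply: (@leq_ltn_trans (A * C * (n * n))); last by rewrite ltn_mul2l nn muln_gt0 pa0 (leq_trans _ p3).
apply: leq_mul; last by rewrite leq_mul2l Ln orbT.
by apply: leq_trans (ltnW pa) (leq_pmulr _ _); apply: leq_trans p3.
Qed.

Theorem theorem1p5 (R : realType) (C : graph_class)
    (bC : bounded_twin_width C) (c : R) (hc : (0 < c)%R) :
  exists (prog : cmd) (k K : nat),
    0 < k /\
    forall (n : nat) (G : sgraph n), 1 < n -> C n G ->
      (1 - n%:R `^ (- c) <=
       apsp_success_prob R (word_length k n)
         (K * (n ^ 2 * up_log 2 n ^ 2))%N prog G)%R.
Proof.
have [d twC] := bC.
have c0 : (0 <= 4 * (c + 2))%R by rewrite mulr_ge0 ?addr_ge0 // ltW.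
(* The oversampling factor: any natural number above 4 (c + 2) serves. The time constant depends
   only on it and on [d]. *)
set a := Num.bound (4 * (c + 2))%R.
have ha : (4 * (c + 2) <= a%:R)%R by apply: ltW; apply: archi_boundP.
exists (apsp_cmd a), (a + 5), (3000 + 300 * a + 500 * (d.+1 * 2 ^ d.+2) * a).
split; first by rewrite addnS.
move=> n G n1 CG; have [big NB] := word_length_large a n1.
set w := word_length _ _ in big NB *; set K := _ + _ * a; set T := K * _.
(* The finite tape must contain all draws, since [tape_of] yields 0 beyond its [T] words. *)
have NT : a * (n * up_log 2 n) <= T.
  have aK : a <= K by rewrite /K; move: (500 * _ * _); lia.
  rewrite /T leq_mul // -!mulnn; have L0 : 0 < up_log 2 n by rewrite up_log_gt0.
  by apply: leq_mul; rewrite leq_pmulr //; lia.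
apply: (prob_separating n1 _ hc ha NT) => [|o sep]; first by clear -n1 big; nia.
rewrite inE; apply/asboolP.
have [t [s [ex [out le]]]] := run_apsp n1 big (twC _ _ CG) NB sep.
by exists t, s.
Qed.
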